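(* Let $Q>0$, $N>0$, $X_0\sim\mathcal N(0,Q)$, $Z_1\sim\mathcal N(0,N)$ independent, $X_1=X_0+U_1$, $Y_1=X_1+Z_1$, and for a control $U_1=\gamma_1(X_0)$ let the power cost be $P=\mathbb E[U_1^2]$ and the estimation cost be $S=\mathbb E[(X_1-\mathbb E[X_1\mid Y_1])^2]$. (i) (Optimal linear strategy.) Let $$S_\ell(P)=\frac{(\sqrt Q-\sqrt P)^2N}{(\sqrt Q-\sqrt P)^2+N}\quad\text{for }P\in[0,Q].$$ Then $\lim_{P\to0^+}\frac{dS_\ell(P)}{dP}=-\infty$. (ii) (BPSK LoPE strategy.) For $a\ge0$ let $U_1=-a\,\mathrm{sign}(X_0)$, with power cost $P_{\mathrm{BPSK}}(a)=a^2$ and estimation cost $S_{\mathrm{BPSK}}(a)$. Then the estimation cost, viewed as a function of the power $P=a^2$, satisfies $$\lim_{a\to0^+}\frac{\partial S_{\mathrm{BPSK}}(a)}{\partial P_{\mathrm{BPSK}}(a)}=\lim_{a\to0^+}\frac{1}{2a}\frac{dS_{\mathrm{BPSK}}(a)}{da}=-\infty.$$ In particular, both strategies have estimation-cost derivative $S'(P)=-\infty$ at $P=0$, where $S(0)=\frac{QN}{Q+N}$.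
   Context: Setting of the Witsenhausen counterexample: the first decision-maker observes $X_0$ and outputs $U_1$; the second observes $Y_1$ and outputs the minimum mean-square error estimate $\mathbb E[X_1\mid Y_1]$. $S_\ell(P)$ is the estimation cost of the best linear policy $U_1=-\sqrt{P/Q}\,X_0$ at power $P\le Q$. The BPSK strategy is the $n=1$ case of the low-power estimation (LoPE) scheme. *)

(* Defs.v *)
From HB Require Import structures.
From mathcomp Require Import all_boot all_order all_algebra.
From mathcomp Require Import all_classical all_reals all_analysis.
Set Implicit Arguments. Unset Strict Implicit. Unset Printing Implicit Defensive.
Import Order.TTheory GRing.Theory Num.Theory.
Import numFieldNormedType.Exports.
Local Open Scope classical_set_scope.
Local Open Scope ring_scope.

Section Witsenhausen.
Variable R : realType.
Local Notation mu := (@lebesgue_measure R).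

(* Gaussian density of N(0, v) (v = variance; normal_pdf takes the std dev). *)
Definition gauss (v x : R) : R := normal_pdf 0 (Num.sqrt v) x.

Definition state1 (gamma : R -> R) (x0 : R) : R := x0 + gamma x0.

Definition ydens (Q N : R) (gamma : R -> R) (y : R) : R :=
  Rintegral mu setT (fun x0 => gauss N (y - state1 gamma x0) * gauss Q x0).

(* MMSE estimator E[X1 | Y1 = y] (Bayes formula). *)
Definition mmse_est (Q N : R) (gamma : R -> R) (y : R) : R :=
  Rintegral mu setT
    (fun x0 => state1 gamma x0 * gauss N (y - state1 gamma x0) * gauss Q x0)
  / ydens Q N gamma y.

Definition est_cost (Q N : R) (gamma : R -> R) : R :=
  Rintegral mu setT (fun x0 =>
    Rintegral mu setT (fun z =>
      (state1 gamma x0 - mmse_est Q N gamma (state1 gamma x0 + z)) ^+ 2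
      * gauss N z) * gauss Q x0).

Definition power_cost (Q : R) (gamma : R -> R) : R :=
  Rintegral mu setT (fun x0 => gamma x0 ^+ 2 * gauss Q x0).

Definition S_lin (Q N P : R) : R :=
  (Num.sqrt Q - Num.sqrt P) ^+ 2 * N / ((Num.sqrt Q - Num.sqrt P) ^+ 2 + N).

Definition bpsk (a : R) : R -> R := fun x0 => - a * Num.sg x0.

Definition S_bpsk (Q N a : R) : R := est_cost Q N (bpsk a).
Definition P_bpsk (Q a : R) : R := power_cost Q (bpsk a).

End Witsenhausen.

(* Main.v *)
Require Import Defs.
From HB Require Import structures.
From mathcomp Require Import all_boot all_order all_algebra.
From mathcomp Require Import all_classical all_reals all_analysis.
From mathcomp Require Import measurable_realfun lebesgue_integral_under.
From mathcomp Require Import ring lra.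
Import Order.TTheory GRing.Theory Num.Theory.
Import numFieldNormedType.Exports.
Local Open Scope classical_set_scope.
Local Open Scope ring_scope.

(** The linear part is a direct computation.  For BPSK write [S(a)] for the
estimation cost and [M(a)] for the second moment of [X1].  Comparing the MMSE
estimator with the linear estimator [k * y], [k = Q / (Q + N)], which is
optimal at [a = 0], gives [S(a) <= (1 - k)^2 M(a) + k^2 N] for all [a] of
either sign, with equality at [a = 0].  So if [S] is differentiable at [0], its
derivative there is that of the right-hand side, namely
[- 2 (1 - k)^2 E|X0| < 0], and [S'(a) / (2 a)] tends to [-oo] as soon as [S'] is
continuous at [0].

For the regularity of [S], Tonelli gives [S(a) = M(a) - E[E[X1 | Y1]^2]], and
completing the square on each half-line [x0 > 0], [x0 < 0] expresses the density
of [Y1] and the MMSE estimator through the normal distribution function.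
Relative to a fixed Gaussian weight, the integrand and its derivative in [a] are
then bounded by [C e^(b |y|)] uniformly for [a] in [(-1, 1)], which allows
differentiation under the integral sign. *)

(** * Integrability of linear combinations *)

Section integrable_EFin.
Context d {T : measurableType d} {R : realType}.
Variable mu : {measure set T -> \bar R}.
Implicit Types f g : T -> R.

Lemma integrableZl_EFin (k : R) f : mu.-integrable setT (fun x => (f x)%:E) ->
  mu.-integrable setT (fun x => (k * f x)%:E).
Proof. by move=> fi; apply: (integrableZl measurableT k fi). Qed.

Lemma integrableD_EFin f g : mu.-integrable setT (fun x => (f x)%:E) ->
  mu.-integrable setT (fun x => (g x)%:E) ->
  mu.-integrable setT (fun x => (f x + g x)%:E).
Proof. by move=> fi gi; apply: (integrableD measurableT fi gi). Qed.

Lemma integrableB_EFin f g : mu.-integrable setT (fun x => (f x)%:E) ->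
  mu.-integrable setT (fun x => (g x)%:E) ->
  mu.-integrable setT (fun x => (f x - g x)%:E).
Proof. by move=> fi gi; apply: (integrableB measurableT fi gi). Qed.
End integrable_EFin.
Arguments integrableZl_EFin {d T R mu}.
Arguments integrableD_EFin {d T R mu f g}.
Arguments integrableB_EFin {d T R mu f g}.

(** * Reflections, translations and half-line splitting of Lebesgue integrals *)

Section reflection.
Context {R : realType}.
Local Notation mu := (@lebesgue_measure R).

Lemma measurable_reflect (c : R) :
  measurable_fun [set: R] (fun x : R => c - x : measurableTypeR R).
Proof. by apply: measurable_funB. Qed.

(** Lebesgue measure is determined by its values on half-open intervals, and the preimage of []a,
    b]] is [[c - b, c - a[], of the same length. *)
Lemma lebesgue_measure_reflect (c : R) (A : set R) : measurable A ->
  pushforward mu (fun x : R => c - x : measurableTypeR R) A = mu A.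
Proof.
move=> mA; apply/esym/lebesgue_measure_unique => //=; first exact: measurable_reflect.
move=> mphi _ [[a b]] _ <-.
rewrite /pushforward.
rewrite (_ : _ @^-1` _ = `[c - b, c - a[%classic); last first.
  by apply/seteqP; split => x /=; rewrite !in_itv /= => /andP[? ?]; lra.
rewrite !lebesgue_measure_itv/=.
rewrite !lte_fin ltrD2l ltrN2; case: ifP => // _.
by rewrite -!EFinB; congr EFin; ring.
Qed.

Lemma ge0_integral_reflect (c : R) (D : set R) (f : R -> \bar R) :
  measurable D -> measurable_fun D f -> (forall x, D x -> 0 <= f x)%E ->
  (\int[mu]_(x in D) f x
   = \int[mu]_(x in (fun x => (c - x)%R) @^-1` D) f (c - x)%R)%E.
Proof.
move=> mD mf f0.
rewrite -(@ge0_integral_pushforward _ _ (measurableTypeR R) (measurableTypeR R)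
  R _ (measurable_reflect c) mu D f) //.
  apply: eq_measure_integral; first exact: measurable_reflect.
  by move=> mphi A mA AS; exact/esym/lebesgue_measure_reflect.
by move=> x /set_mem; exact: f0.
Qed.

Lemma Rintegral_reflect (c : R) (D : set R) (f : R -> R) :
  measurable D -> measurable_fun setT f ->
  mu.-integrable ((fun x => c - x) @^-1` D) (fun x => (f (c - x))%:E) ->
  \int[mu]_(x in D) f x = \int[mu]_(x in (fun x => c - x) @^-1` D) f (c - x).
Proof.
move=> mD mf fi; rewrite /Rintegral; congr fine.
rewrite -(@integral_pushforward _ _ (measurableTypeR R) (measurableTypeR R)
  R _ (measurable_reflect c) mu D (EFin \o f)) //.
  apply: eq_measure_integral; first exact: measurable_reflect.
  by move=> mphi A mA AS; exact/esym/lebesgue_measure_reflect.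
exact/measurable_EFinP.
Qed.

Lemma integrable_reflect (c : R) (D : set R) (f : R -> R) :
  measurable D -> measurable_fun setT f ->
  mu.-integrable D (EFin \o f) ->
  mu.-integrable ((fun x => c - x) @^-1` D) (fun x => (f (c - x))%:E).
Proof.
move=> mD mf /integrableP[_ fi].
have mphi := measurable_reflect c.
have mphiD : measurable ((fun x => c - x) @^-1` D).
  by rewrite -(setTI (_ @^-1` _)); exact: mphi.
apply/integrableP; split.
  by apply/measurable_EFinP/measurable_funTS; exact: (measurableT_comp mf mphi).
move: fi; rewrite (@ge0_integral_reflect c) //.
by apply: measurableT_comp => //; exact/measurable_EFinP/measurable_funTS.
Qed.

Lemma preimage_reflect_gt (c : R) :
  (fun x => c - x) @^-1` `]0, +oo[%classic = `]-oo, c[%classic :> set R.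
Proof.
by apply/seteqP; split => x /=; rewrite !in_itv /= andbT subr_gt0.
Qed.

Lemma preimage_reflect0_lt :
  (fun x => 0 - x) @^-1` `]-oo, 0[%classic = `]0, +oo[%classic :> set R.
Proof.
by apply/seteqP; split => x /=; rewrite !in_itv /= andbT; lra.
Qed.

(** A translation is the composite of two reflections: [x + c = 0 - (- c - x)]. *)
Lemma ge0_integral_shift (c : R) (f : R -> \bar R) :
  measurable_fun setT f -> (forall x, 0 <= f x)%E ->
  (\int[mu]_x f x = \int[mu]_x f (x + c)%R)%E.
Proof.
move=> mf f0.
rewrite (@ge0_integral_reflect 0) // preimage_setT.
rewrite (@ge0_integral_reflect (- c)) // ?preimage_setT.
  by apply: eq_integral => x _; congr f; ring.
by apply: (measurableT_comp mf); exact: measurable_reflect.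
Qed.

Lemma integral_lt_le (c : R) (f : R -> R) : mu.-integrable setT (EFin \o f) ->
  \int[mu]_(x in `]-oo, c[) f x = \int[mu]_(x in `]-oo, c]) f x.
Proof.
move=> fi; apply: Rintegral_itv_bndo_bndc.
by apply: integrableS fi.
Qed.

(** On each half the BPSK control is constant, and the negative half is carried onto the positive
    one. The point [0] is a null set. *)
Lemma Rintegral_half (f : R -> R) : mu.-integrable setT (EFin \o f) ->
  \int[mu]_x f x = \int[mu]_(x in `]0, +oo[) f x + \int[mu]_(x in `]0, +oo[) f (- x).
Proof.
move=> fi.
have mf : measurable_fun setT f by case/integrableP : fi => /measurable_EFinP.
have -> : [set: R] = `]-oo, 0]%classic `|` `]0, +oo[%classic.
  by apply/seteqP; split => x //= _; rewrite !in_itv /= andbT; case: (leP x 0); [left|right].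
rewrite Rintegral_setU //; last first.
- by apply/disj_setPS => x []; rewrite /= !in_itv /= andbT; lra.
- by apply: integrableS fi => //; apply: measurableU.
rewrite addrC; congr (_ + _).
rewrite -integral_lt_le // (@Rintegral_reflect 0) //.
  rewrite preimage_reflect0_lt.
  by apply: eq_Rintegral => x _; rewrite sub0r.
apply: integrable_reflect => //.
by apply: integrableS fi.
Qed.

(** Meant for integrands containing [Num.sg]: an identity such as [Num.sg x ^+ 2 = 1] fails only at
    [0], a null set. *)
Lemma eq_Rintegral_neq0 (f g : R -> R) : (forall x, x != 0 -> f x = g x) ->
  measurable_fun setT f -> measurable_fun setT g ->
  \int[mu]_x f x = \int[mu]_x g x.
Proof.
move=> fg mf mg; congr fine.
apply: ae_eq_integral => //; [exact/measurable_EFinP..|].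
exists [set 0]; split => //; first exact: lebesgue_measure_set1.
move=> x /= /not_implyP[_ fgx].
by apply/eqP; apply: contra_notT fgx => /fg ->.
Qed.

End reflection.

(** * Gaussian densities against exponential growth *)

Section gaussian.
Context {R : realType}.
Local Notation mu := (@lebesgue_measure R).
Implicit Types v x y t s a : R.

Definition peak v : R := (Num.sqrt (v * pi *+ 2))^-1.

Lemma peak_gt0 v : 0 < v -> 0 < peak v.
Proof.
by move=> v0; rewrite invr_gt0 sqrtr_gt0 mulrn_wgt0 // mulr_gt0 // pi_gt0.
Qed.

Lemma gaussE v x : 0 < v -> gauss v x = peak v * expR (- (x ^+ 2 / (2 * v))).
Proof.
move=> v0; rewrite /gauss normal_pdfE ?gt_eqF ?sqrtr_gt0 //.
rewrite /normal_peak /normal_fun subr0 sqr_sqrtr ?ltW // /peak.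
by rewrite mulNr (mulr_natl v 2).
Qed.

Lemma gauss_gt0 v x : 0 < v -> 0 < gauss v x.
Proof. by move=> v0; rewrite gaussE // mulr_gt0 ?expR_gt0 ?peak_gt0. Qed.

Lemma gauss_ge0 v x : 0 < v -> 0 <= gauss v x.
Proof. by move=> v0; exact/ltW/gauss_gt0. Qed.

Lemma gauss_le_peak v x : 0 < v -> gauss v x <= peak v.
Proof.
move=> v0; rewrite gaussE // ler_piMr ?(ltW (peak_gt0 _ v0)) //.
by rewrite -[leRHS]expR0 ler_expR oppr_le0 divr_ge0 ?sqr_ge0 // mulr_ge0 // ltW.
Qed.

Lemma gaussN v x : 0 < v -> gauss v (- x) = gauss v x.
Proof. by move=> v0; rewrite !gaussE // sqrrN. Qed.

Lemma measurable_gauss v : measurable_fun [set: R] (gauss v).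
Proof. exact: measurable_normal_pdf. Qed.

Lemma integral_gauss v : (\int[mu]_x (gauss v x)%:E = 1)%E.
Proof. exact: integral_normal_pdf. Qed.

Lemma integrable_gauss v : mu.-integrable [set: R] (EFin \o gauss v).
Proof. exact: integrable_normal_pdf. Qed.

(** Completing the square in [x]: the joint density of [X0] and [X0 + Z1] is the marginal density of
    the sum times the posterior density of [X0], of mean [Q / (Q + N) * t] and variance
    [Q * N / (Q + N)]. *)
Lemma gauss_mul N Q t x : 0 < N -> 0 < Q ->
  gauss N (t - x) * gauss Q x
  = gauss (Q + N) t * gauss (Q * N / (Q + N)) (x - Q / (Q + N) * t).
Proof.
move=> N0 Q0; have V0 : 0 < Q + N by exact: addr_gt0.
have v0 : 0 < Q * N / (Q + N) by rewrite divr_gt0 ?mulr_gt0.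
rewrite !gaussE // mulrACA [RHS]mulrACA -!expRD; congr (_ * expR _); last first.
  by field; rewrite !gt_eqF ?mulr_gt0.
rewrite /peak -!invfM -!sqrtrM; last 2 first.
- by rewrite mulrn_wge0 // mulr_ge0 ?pi_ge0 ?ltW.
- by rewrite mulrn_wge0 // mulr_ge0 ?pi_ge0 ?ltW.
by congr (Num.sqrt _)^-1; field; rewrite gt_eqF.
Qed.

(** Moves the shift out of the Gaussian, so that integrals in [y] can keep a weight that does not
    depend on [a]. *)
Lemma gaussD v y a : 0 < v ->
  gauss v (y + a) = gauss v y * expR (- (a ^+ 2 / (2 * v))) * expR (- (y * a / v)).
Proof.
move=> v0; rewrite !gaussE // -!mulrA -!expRD; congr (_ * expR _).
by field; rewrite gt_eqF.
Qed.

Lemma is_derive_gauss v x : 0 < v ->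
  is_derive x 1 (gauss v) (- (x / v) * gauss v x).
Proof.
move=> v0; have -> : gauss v = (fun x => peak v * expR (- (x ^+ 2 / (2 * v)))).
  by apply/funext => z; exact: gaussE.
apply: is_derive_eq.
rewrite /GRing.scale /=; field; rewrite gt_eqF //.
Qed.

Lemma continuous_gauss v : 0 < v -> continuous (gauss v).
Proof. by move=> v0; apply: continuous_normal_pdf; rewrite gt_eqF ?sqrtr_gt0. Qed.

(** The bound is uniform in the parameter [a], as a dominating function requires. A single function
    is treated as a family constant in [a]. *)
Definition exp_growth (I : set R) (f : R -> R -> R) :=
  exists C b : R, [/\ 0 <= C, 0 <= b &
    forall a y, I a -> `|f a y| <= C * expR (b * `|y|)].

(** Half of the Gaussian exponent absorbs the exponential: the two exponents differ by
    [(|y| - 2 v b)^2 / (4 v)], and a Gaussian of doubled variance remains. *)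
Lemma expR_gauss_le v b y : 0 < v ->
  expR (b * `|y|) * gauss v y
  <= peak v / peak (2 * v) * expR (b ^+ 2 * v) * gauss (2 * v) y.
Proof.
move=> v0; rewrite !gaussE ?mulr_gt0 //.
have -> : peak v / peak (2 * v) * expR (b ^+ 2 * v) *
   (peak (2 * v) * expR (- (y ^+ 2 / (2 * (2 * v))))) =
   peak v * (expR (b ^+ 2 * v) * expR (- (y ^+ 2 / (2 * (2 * v))))).
  by field; rewrite gt_eqF // peak_gt0 ?mulr_gt0.
rewrite mulrCA ler_pM2l ?peak_gt0 // -!expRD ler_expR -subr_ge0.
rewrite (_ : _ - _ = (`|y| - 2 * v * b) ^+ 2 / (4 * v)); last first.
  by rewrite -(real_normK (num_real y)); field; rewrite gt_eqF.
by rewrite divr_ge0 ?sqr_ge0 // mulr_ge0 // ltW.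
Qed.

Lemma integrable_exp_growth v (I : set R) (f : R -> R -> R) a : 0 < v -> I a ->
  measurable_fun setT (f a) -> exp_growth I f ->
  mu.-integrable setT (fun y => (f a y * gauss v y)%:E).
Proof.
move=> v0 Ia mf [C [b [C0 b0 fC]]].
pose K := C * (peak v / peak (2 * v) * expR (b ^+ 2 * v)).
apply: (@le_integrable _ _ _ mu _ measurableT _ (fun y => K%:E * (gauss (2 * v) y)%:E)%E).
- apply/measurable_EFinP/measurable_funM => //; exact: measurable_gauss.
- move=> y _; rewrite -EFinM /= lee_fin (le_trans _ (ler_norm _)) //.
  rewrite normrM (ger0_norm (gauss_ge0 _ _ v0)) // /K -[leRHS]mulrA.
  apply: le_trans (ler_wpM2l C0 (expR_gauss_le _ b y v0)).
  by rewrite mulrA ler_wpM2r ?gauss_ge0 ?fC.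
- by apply: integrableZl => //; exact: integrable_gauss.
Qed.

(** With [u = z ^+ 2 / (2 * v)] this reduces to [u <= expR u], a consequence of [1 + u <= expR u].
    It provides the decay at infinity of the antiderivatives used below. *)
Lemma sqr_gauss_bounded v : 0 < v -> exists C, forall z, z ^+ 2 * gauss v z <= C.
Proof.
move=> v0; exists (peak v * (2 * v)) => z; rewrite gaussE // mulrCA.
rewrite ler_pM2l ?peak_gt0 // expRN ler_pdivrMr ?expR_gt0 //.
set u := z ^+ 2 / (2 * v).
have -> : z ^+ 2 = (2 * v) * u by rewrite /u; field; rewrite gt_eqF.
rewrite ler_pM2l ?mulr_gt0 //.
by rewrite (le_trans _ (expR_ge1Dx u)) // lerDr.
Qed.

End gaussian.

(** * Stability of exponential growth under algebraic operations *)

Section exp_growth.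
Context {R : realType}.
Variable I : set R.
Implicit Types f g : R -> R -> R.

Lemma exp_growth_le f g : (forall a y, I a -> `|f a y| <= `|g a y|) ->
  exp_growth I g -> exp_growth I f.
Proof.
move=> fg [C [b [C0 b0 gC]]]; exists C, b; split => // a y Ia.
exact: le_trans (fg _ _ Ia) (gC _ _ Ia).
Qed.

Lemma exp_growth_bounded f C : (forall a y, I a -> `|f a y| <= C) ->
  exp_growth I f.
Proof.
move=> fC; exists `|C|, 0; split => // a y Ia.
by rewrite mul0r expR0 mulr1 (le_trans (fC _ _ Ia)) // ler_norm.
Qed.

Lemma exp_growth_cst (c : R) : exp_growth I (fun _ _ => c).
Proof. exact: (@exp_growth_bounded _ `|c|). Qed.

Lemma exp_growth_expR (h : R -> R -> R) (c : R) :
  (forall a y, I a -> `|h a y| <= c * `|y|) -> exp_growth I (fun a y => expR (h a y)).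
Proof.
move=> hc; exists 1, `|c|; split => // a y Ia.
rewrite mul1r ger0_norm ?expR_ge0 // ler_expR.
apply: le_trans (ler_norm _) (le_trans (hc _ _ Ia) _).
by rewrite ler_wpM2r // ler_norm.
Qed.

Lemma exp_growth_snd : exp_growth I (fun _ y => y).
Proof.
exists 1, 1; split => // a y _.
by rewrite !mul1r (le_trans _ (expR_ge1Dx _)) // lerDr.
Qed.

Lemma exp_growthD f g : exp_growth I f -> exp_growth I g ->
  exp_growth I (fun a y => f a y + g a y).
Proof.
move=> [C [b [C0 b0 fC]]] [D [d [D0 d0 gD]]].
exists (C + D), (b + d); split; [exact: addr_ge0..|] => a y Ia.
rewrite (le_trans (ler_normD _ _)) // mulrDl lerD //.
- rewrite (le_trans (fC _ _ Ia)) // ler_wpM2l // ler_expR.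
  by rewrite ler_wpM2r // lerDl.
- rewrite (le_trans (gD _ _ Ia)) // ler_wpM2l // ler_expR.
  by rewrite ler_wpM2r // lerDr.
Qed.

Lemma exp_growthN f : exp_growth I f -> exp_growth I (fun a y => - f a y).
Proof. by apply: exp_growth_le => a y _; rewrite normrN. Qed.

Lemma exp_growthB f g : exp_growth I f -> exp_growth I g ->
  exp_growth I (fun a y => f a y - g a y).
Proof. by move=> ef eg; exact/exp_growthD/exp_growthN. Qed.

Lemma exp_growthM f g : exp_growth I f -> exp_growth I g ->
  exp_growth I (fun a y => f a y * g a y).
Proof.
move=> [C [b [C0 b0 fC]]] [D [d [D0 d0 gD]]].
exists (C * D), (b + d); split; [exact: mulr_ge0|exact: addr_ge0|] => a y Ia.
by rewrite normrM mulrDl expRD mulrACA ler_pM ?fC ?gD.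
Qed.

Lemma exp_growthX f n : exp_growth I f -> exp_growth I (fun a y => f a y ^+ n).
Proof.
move=> ef; elim: n => [|n IH].
  by under [X in exp_growth _ X]eq_fun do under eq_fun do rewrite expr0;
     exact: exp_growth_cst.
under [X in exp_growth _ X]eq_fun do under eq_fun do rewrite exprS.
exact: exp_growthM.
Qed.

Lemma exp_growthN_snd f : exp_growth I f -> exp_growth I (fun a y => f a (- y)).
Proof.
move=> [C [b [C0 b0 fC]]]; exists C, b; split => // a y Ia.
by rewrite -(normrN y); exact: fC.
Qed.

Lemma exp_growthV f c d : 0 < c ->
  (forall a y, I a -> c * expR (- d * `|y|) <= f a y) ->
  exp_growth I (fun a y => (f a y)^-1).
Proof.
move=> c0 fc; exists c^-1, `|d|; split => //.
  by rewrite invr_ge0 ltW.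
move=> a y Ia; have f0 : 0 < f a y.
  by apply: lt_le_trans (fc _ _ Ia); rewrite mulr_gt0 ?expR_gt0.
rewrite normfV gtr0_norm // -[leRHS]invrK lef_pV2 ?posrE //; last first.
  by rewrite invr_gt0 mulr_gt0 ?invr_gt0 ?expR_gt0.
rewrite invfM invrK -expRN -mulNr (le_trans _ (fc _ _ Ia)) //.
rewrite ler_pM2l // ler_expR ler_wpM2r // lerN2; exact: ler_norm.
Qed.
End exp_growth.

(** * Fundamental theorem of calculus on a lower half-line *)

Section half_line.
Context {R : realType}.
Local Notation mu := (@lebesgue_measure R).

(** Limit of the theorem on [[s - n - 1, s]], by dominated convergence with majorant [|f|]. The
    bound on [|F x| * |x|] makes [F] vanish at [-oo]. *)
Lemma integral_Ny_FTC (f F : R -> R) (s C : R) :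
  mu.-integrable setT (EFin \o f) -> continuous f ->
  (forall x : R, is_derive x 1 F (f x)) -> (forall x, `|F x| * `|x| <= C) ->
  \int[mu]_(x in `]-oo, s]) f x = F s.
Proof.
move=> fi cf dF FC.
have mf : measurable_fun setT f by case/integrableP : fi => /measurable_EFinP.
(* Indicators keep the domain fixed for dominated convergence; [n.+1] keeps the interval
   nondegenerate at [n = 0]. *)
pose g n x := f x * \1_`[s - n.+1%:R, s] x.
have intg n : \int[mu]_x g n x = F s - F (s - n.+1%:R).
  have -> : \int[mu]_x g n x = \int[mu]_(x in `[s - n.+1%:R, s]) f x.
    rewrite [RHS]Rintegral_mkcond; apply: eq_Rintegral => x _.
    by rewrite /g patchE indicE; case: ifP => _; rewrite ?mulr1 ?mulr0.
  rewrite /Rintegral (@continuous_FTC2 _ f F) //.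
  - by rewrite ltrBlDr ltrDl.
  - exact: continuous_subspaceT.
  - have cF : continuous F.
      by move=> x; apply/differentiable_continuous/derivable1_diffP; apply: ex_derive.
    split=> [x _||]; first exact: ex_derive.
      by apply: cvg_at_right_filter; exact: cF.
    by apply: cvg_at_left_filter; exact: cF.
  - by move=> x _; rewrite derive1E; exact: derive_val.
(* [|F (s - n - 1)|] is at most [C / |s - n - 1|], hence at most [e] once [n >= s + C / e]. *)
have cvgF : F s - F (s - n.+1%:R) @[n --> \oo] --> F s.
  rewrite -[X in _ --> X]subr0; apply: cvgB; first exact: cvg_cst.
  apply/cvgrPdist_le => e e0; near=> n; rewrite sub0r normrN.
  have sn : 0 < `|s - n.+1%:R|.
    rewrite normr_gt0 subr_eq0 lt_eqF // -natr1.
    rewrite (@lt_trans _ _ n%:R) ?ltrDl //.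
    by near: n; exact: nbhs_infty_gtr.
  rewrite -(ler_pM2r sn) (le_trans (FC _)) // -ler_pdivrMl //.
  rewrite ler0_norm ?opprB; last first.
    rewrite subr_le0 -natr1 ler_wpDr //.
    by near: n; exact: nbhs_infty_ger.
  rewrite lerBrDr -natr1 ler_wpDr //.
  by near: n; exact: nbhs_infty_ger.
pose h x := f x * \1_`]-oo, s] x.
have intf : \int[mu]_(x in `]-oo, s]) f x = \int[mu]_x h x.
  rewrite Rintegral_mkcond; apply: eq_Rintegral => x _.
  by rewrite /h patchE indicE; case: ifP => _; rewrite ?mulr1 ?mulr0.
rewrite intf.
have mg n : measurable_fun setT (g n).
  by apply: measurable_funM => //; exact: measurable_indic.
have mh : measurable_fun setT h.
  by apply: measurable_funM => //; exact: measurable_indic.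
have mEg n : measurable_fun setT (EFin \o g n) by exact/measurable_EFinP.
have mEh : measurable_fun setT (EFin \o h) by exact/measurable_EFinP.
have cvgg : {ae mu, forall x, [set: R] x -> (EFin \o g n) x @[n --> \oo] --> (EFin \o h) x}.
  apply: aeW => x _; apply: cvg_EFin; first exact: nearW.
  apply: cvg_near_cst; near=> n; rewrite /= /g /h !indicE; congr (_ * (nat_of_bool _)%:R).
  rewrite !mem_setE /= !in_itv /=; apply: andb_idl => xs.
  rewrite lerBlDr -lerBlDl -natr1 ler_wpDr //.
  by near: n; exact: nbhs_infty_ger.
have gf : {ae mu, forall x n, [set: R] x -> (`|(EFin \o g n) x| <= (abse \o (EFin \o f)) x)%E}.
  apply: aeW => x n _; rewrite /= lee_fin /g normrM ler_piMr //.
  by rewrite indicE; case: (_ \in _) => /=; rewrite ?normr0 ?normr1.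
have [ih _ cvgi] := @dominated_convergence _ (measurableTypeR R) R mu setT
  measurableT _ _ _ mEg mEh cvgg (integrable_abse fi) gf.
apply: (@cvg_unique _ (@Rhausdorff R) ((fun n => \int[mu]_x g n x) @ \oo)).
  apply: fine_cvg; rewrite fineK //; exact: integrable_fin_num.
by rewrite (funext intg).
Unshelve. all: by end_near. Qed.
End half_line.

(** * Full and half-line moments of a Gaussian *)

Section gaussian_moments.
Context {R : realType}.
Local Notation mu := (@lebesgue_measure R).
Variables (v : R) (v0 : 0 < v).
Implicit Types s z : R.

(** The substitution [x = s - z] centres a Gaussian of mean [s] and turns the half-line into the
    domain of integration of [gcdf s]. *)
Lemma Rintegral_gt0_reflect (f : R -> R) s : mu.-integrable setT (EFin \o f) ->
  \int[mu]_(x in `]0, +oo[) f x = \int[mu]_(z in `]-oo, s]) f (s - z).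
Proof.
move=> fi.
have mf : measurable_fun setT f by case/integrableP : fi => /measurable_EFinP.
rewrite (Rintegral_reflect s) ?preimage_reflect_gt //.
  apply: integral_lt_le; have := integrable_reflect s setT f measurableT mf fi.
  by rewrite preimage_setT.
rewrite -preimage_reflect_gt; apply: integrable_reflect => //.
by apply: integrableS fi.
Qed.
Lemma integrable_gauss_poly2 (a b c : R) :
  mu.-integrable setT (fun z => ((a + b * z + c * z ^+ 2) * gauss v z)%:E).
Proof.
apply: (@integrable_exp_growth _ v setT (fun _ z => a + b * z + c * z ^+ 2) 0) => //.
  apply: measurable_funD; first apply: measurable_funD => //.
  by apply: measurable_funM => //; exact: measurable_funX.
apply: exp_growthD; first apply: exp_growthD.
- exact: exp_growth_cst.
- by apply: exp_growthM; [exact: exp_growth_cst|exact: exp_growth_snd].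
- by apply: exp_growthM; [exact: exp_growth_cst|apply: exp_growthX; exact: exp_growth_snd].
Qed.

Lemma integrable_id_gauss : mu.-integrable setT (fun z => (z * gauss v z)%:E).
Proof.
have := integrable_gauss_poly2 0 1 0; apply: eq_integrable => // z _.
by congr EFin; ring.
Qed.

Lemma integrable_sqr_gauss : mu.-integrable setT (fun z => (z ^+ 2 * gauss v z)%:E).
Proof.
have := integrable_gauss_poly2 0 0 1; apply: eq_integrable => // z _.
by congr EFin; ring.
Qed.

Definition gcdf s := \int[mu]_(z in `]-oo, s]) gauss v z.

(** For [Z] of law N(0, v) this is [E[max(s + Z, 0)]]; it is also an antiderivative of [gcdf]. *)
Definition gmean s := v * gauss v s + s * gcdf s.

Lemma is_derive_gcdf s : is_derive s 1 gcdf (gauss v s).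
Proof.
have [] := @continuous_FTC1 _ (gauss v) -oo%O s (s + 1) _ _ _ _.
- by rewrite ltrDl.
- by apply: integrableS (integrable_gauss v).
- by rewrite ltNyr.
- exact: continuous_gauss.
by move=> dg gE; split; [exact: dg|rewrite -derive1E; exact: gE].
Qed.

Lemma is_derive_gmean s : is_derive s 1 gmean (gcdf s).
Proof.
have dgauss := is_derive_gauss v s v0; have dgcdf := is_derive_gcdf s.
apply: is_derive_eq; rewrite /GRing.scale /=; field; rewrite gt_eqF //.
Qed.

Lemma continuous_gcdf : continuous gcdf.
Proof.
by move=> s; apply/differentiable_continuous/derivable1_diffP; apply: ex_derive;
  exact: is_derive_gcdf.
Qed.

Lemma gcdf_ge0 s : 0 <= gcdf s.
Proof. by apply: Rintegral_ge0 => z _; exact: gauss_ge0. Qed.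

Lemma gcdf_lt : {homo gcdf : s t / s < t}.
Proof.
move=> s t st; rewrite -subr_gt0.
have [c _ ->] := @MVT _ gcdf (gauss v) s t st (fun x _ => is_derive_gcdf x)
  (continuous_subspaceT continuous_gcdf).
by rewrite mulr_gt0 ?subr_gt0 // gauss_gt0.
Qed.

Lemma gcdf_gt0 s : 0 < gcdf s.
Proof. by apply: le_lt_trans (gcdf_ge0 (s - 1)) (gcdf_lt _ _ _); rewrite ltrBlDr ltrDl. Qed.

(** The density is even, so each half-line has mass [gcdf 0]. *)
Lemma gcdf0 : gcdf 0 + gcdf 0 = 1.
Proof.
have := Rintegral_half _ (integrable_gauss v).
rewrite {1}/Rintegral integral_gauss /= => ->.
have E : \int[mu]_(x in `]0, +oo[) gauss v x = gcdf 0.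
  rewrite (Rintegral_gt0_reflect _ 0 (integrable_gauss v)).
  by apply: eq_Rintegral => z _; rewrite sub0r gaussN.
by rewrite E; congr (_ + _); rewrite -E; apply: eq_Rintegral => z _; rewrite gaussN.
Qed.

(** The left side has derivative [gauss v s - gauss v (- s) = 0], and its value at [0] is known from
    [gcdf0]. *)
Lemma gcdfN s : gcdf s + gcdf (- s) = 1.
Proof.
have d (x : R) : is_derive x 1 (fun x => gcdf x + gcdf (- x)) 0.
  have d1 := is_derive_gcdf x; have d2 := is_derive_gcdf (- x).
  have dN : is_derive x 1 (fun x => - x : R) (- 1) by apply: is_derive_eq.
  have d3 := is_derive1_comp d2 dN.
  have d4 : is_derive x 1 (fun x => gcdf x + gcdf (- x)) (gauss v x + gauss v (- x) * (- 1)).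
    exact: is_deriveD.
  by apply: is_derive_eq d4 _; rewrite gaussN // mulrN1 subrr.
have /= := @is_derive_0_is_cst _ _ s 0 d.
by rewrite oppr0 gcdf0.
Qed.

Lemma gcdf_le1 s : gcdf s <= 1.
Proof. by rewrite -(gcdfN s) lerDl gcdf_ge0. Qed.


Lemma integrable_gauss_center s : mu.-integrable setT (fun x => (gauss v (x - s))%:E).
Proof.
have := integrable_reflect s setT _ measurableT (measurable_gauss v) (integrable_gauss v).
rewrite preimage_setT; apply: eq_integrable => // x _.
by rewrite /= -gaussN // opprB.
Qed.

Lemma Rintegral_gt0_gauss s : \int[mu]_(x in `]0, +oo[) gauss v (x - s) = gcdf s.
Proof.
rewrite (Rintegral_gt0_reflect (fun x => gauss v (x - s)) s).
  by apply: eq_Rintegral => z _; rewrite addrAC subrr sub0r gaussN.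
exact: integrable_gauss_center.
Qed.

(** [v * gauss v z] is an antiderivative of the integrand. Its decay comes from [|x| <= 1 + x ^+ 2]
    and the bounds on [gauss v x] and [x ^+ 2 * gauss v x]. *)
Lemma Rintegral_Ny_id_gauss s :
  \int[mu]_(z in `]-oo, s]) (- z * gauss v z) = v * gauss v s.
Proof.
have [C hC] := sqr_gauss_bounded v v0.
apply: (integral_Ny_FTC _ (fun z => v * gauss v z) s (v * (peak v + C))).
- have := integrable_gauss_poly2 0 (-1) 0; apply: eq_integrable => // z _.
  by congr EFin; ring.
- move=> x; apply: continuousM; last exact: continuous_gauss.
  exact: continuousN.
- move=> x; have dgauss := is_derive_gauss v x v0.
  by apply: is_derive_eq; rewrite /GRing.scale /=; field; rewrite gt_eqF.
- move=> x; rewrite normrM (gtr0_norm v0) -mulrA ler_pM2l //.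
  rewrite ger0_norm ?gauss_ge0 //.
  apply: (@le_trans _ _ ((1 + x ^+ 2) * gauss v x)).
    rewrite mulrC ler_wpM2r ?gauss_ge0 //.
    rewrite -(real_normK (num_real x)); nra.
  by rewrite mulrDl mul1r lerD ?gauss_le_peak.
Qed.

Lemma integrable_shift_gauss s :
  mu.-integrable setT (fun x => (x * gauss v (x - s))%:E).
Proof.
have := integrable_reflect s setT (fun z => (s - z) * gauss v z) measurableT _ _.
rewrite preimage_setT => H.
have : mu.-integrable setT (fun x => ((s - (s - x)) * gauss v (s - x))%:E).
  apply: H.
    apply: measurable_funM; last exact: measurable_gauss.
    exact: measurable_funB.
  have := integrable_gauss_poly2 s (-1) 0; apply: eq_integrable => // z _.
  by congr EFin => /=; ring.
by apply: eq_integrable => // x _; rewrite subKr -gaussN // opprB.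
Qed.

(** After centring, the factor [x] becomes [s - z]: the part [- z] contributes [v * gauss v s] and
    the part [s] contributes [s * gcdf s]. *)
Lemma Rintegral_gt0_id_gauss s :
  \int[mu]_(x in `]0, +oo[) (x * gauss v (x - s)) = gmean s.
Proof.
rewrite (Rintegral_gt0_reflect (fun x => x * gauss v (x - s)) s); last first.
  exact: integrable_shift_gauss.
have -> : \int[mu]_(z in `]-oo, s]) ((s - z) * gauss v (s - z - s)) =
    \int[mu]_(z in `]-oo, s]) (- z * gauss v z + s * gauss v z).
  apply: eq_Rintegral => z _; rewrite addrAC subrr sub0r gaussN //; ring.
rewrite RintegralD //; last 2 first.
- apply: (@integrableS _ _ _ _ setT) => //.
  have := integrable_gauss_poly2 0 (-1) 0; apply: eq_integrable => // z _.
  by congr EFin => /=; ring.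
- apply: (@integrableS _ _ _ _ setT) => //.
  have := integrable_gauss_poly2 s 0 0; apply: eq_integrable => // z _.
  by congr EFin => /=; ring.
rewrite Rintegral_Ny_id_gauss RintegralZl //.
by apply: integrableS (integrable_gauss v).
Qed.

Lemma Rintegral_id_gauss : \int[mu]_x (x * gauss v x) = 0.
Proof.
rewrite Rintegral_half; last exact: integrable_id_gauss.
have -> : \int[mu]_(x in `]0, +oo[) (- x * gauss v (- x)) =
    \int[mu]_(x in `]0, +oo[) (-1 * (x * gauss v x)).
  by apply: eq_Rintegral => x _; rewrite gaussN // mulN1r mulNr.
rewrite RintegralZl ?mulN1r ?subrr //.
by apply: integrableS integrable_id_gauss.
Qed.

Lemma Rintegral_norm_gauss : \int[mu]_x (`|x| * gauss v x) = 2 * v * gauss v 0.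
Proof.
rewrite Rintegral_half; last first.
  apply: (@le_integrable _ _ _ mu _ measurableT _ (fun x => (x * gauss v x)%:E)).
  - by apply/measurable_EFinP/measurable_funM => //; exact: measurable_gauss.
  - by move=> x _; rewrite /= lee_fin !normrM normr_id.
  - exact: integrable_id_gauss.
have E : \int[mu]_(x in `]0, +oo[) (`|x| * gauss v x) = v * gauss v 0.
  have := Rintegral_gt0_id_gauss 0; rewrite /gmean mul0r addr0 => <-.
  apply: eq_Rintegral => x; rewrite inE /= in_itv /= andbT => x0.
  by rewrite subr0 gtr0_norm.
have -> : \int[mu]_(x in `]0, +oo[) (`|- x| * gauss v (- x)) =
    \int[mu]_(x in `]0, +oo[) (`|x| * gauss v x).
  by apply: eq_Rintegral => x _; rewrite normrN gaussN.
rewrite E; ring.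
Qed.

(** The even function [x ^+ 2 * gauss v x - v * gauss v x] is the derivative of
    [- v * x * gauss v x], which vanishes at [0] and at [-oo]; its integral over each half-line is
    therefore zero. *)
Lemma Rintegral_sqr_gauss : \int[mu]_x (x ^+ 2 * gauss v x) = v.
Proof.
pose f x := x ^+ 2 * gauss v x - v * gauss v x.
have fi : mu.-integrable setT (EFin \o f).
  have := integrable_gauss_poly2 (- v) 0 1; apply: eq_integrable => // z _.
  by congr EFin; rewrite /f; ring.
suff f0 : \int[mu]_x f x = 0.
  move: f0; rewrite /f RintegralB //; last 2 first.
  - exact: integrable_sqr_gauss.
  - have := integrable_gauss_poly2 v 0 0; apply: eq_integrable => // z _.
    by congr EFin; ring.
  rewrite RintegralZl //; last exact: integrable_gauss.
  by rewrite [X in _ - v * X]/Rintegral integral_gauss /= mulr1 => /eqP; rewrite subr_eq0 => /eqP.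
have fN x : f (- x) = f x by rewrite /f sqrrN gaussN.
rewrite Rintegral_half // (Rintegral_gt0_reflect f 0) //.
have -> : \int[mu]_(z in `]-oo, 0]) f (0 - z) = \int[mu]_(z in `]-oo, 0]) f z.
  by apply: eq_Rintegral => z _; rewrite sub0r fN.
rewrite (_ : \int[mu]_(x in `]0, +oo[) f (- x) = \int[mu]_(z in `]-oo, 0]) f z); last first.
  rewrite (Rintegral_gt0_reflect (fun x => f (- x)) 0).
    by apply: eq_Rintegral => z _; rewrite sub0r opprK.
  by move: fi; apply: eq_integrable => // x _ /=; rewrite fN.
have [C hC] := sqr_gauss_bounded v v0.
have -> : \int[mu]_(z in `]-oo, 0]) f z = 0; last by rewrite addr0.
(* The right-hand [0] is rewritten as the value at [0] of the antiderivative [- v * z * gauss v z],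
   the form that the half-line theorem produces. *)
rewrite -[RHS](mul0r (gauss v 0)) -[X in X * _](mulr0 (- v)).
apply: (integral_Ny_FTC _ (fun z => - v * z * gauss v z) 0 (v * C)) => //.
- move=> x; apply: (@cvgB _ R^o); apply: cvgM; try exact: continuous_gauss.
  + exact: exprn_continuous.
  + exact: cvg_cst.
- move=> x; have dgauss := is_derive_gauss v x v0.
  by apply: is_derive_eq; rewrite /f /GRing.scale /=; field; rewrite gt_eqF.
- move=> x; rewrite !normrM normrN (gtr0_norm v0) -!mulrA ler_pM2l //.
  rewrite (ger0_norm (gauss_ge0 _ _ v0)) mulrCA -expr2 mulrC.
  by rewrite real_normK ?num_real.
Qed.

(** Stated in the extended reals for use inside nested integrals; the cross term vanishes because
    the Gaussian is centred. *)
Lemma integral_sqr_affine_gauss (a b : R) :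
  (\int[mu]_z ((a + b * z) ^+ 2 * gauss v z)%:E = (a ^+ 2 + b ^+ 2 * v)%:E)%E.
Proof.
have i1 : mu.-integrable setT (fun z => (a ^+ 2 * gauss v z)%:E).
  have := integrable_gauss_poly2 (a ^+ 2) 0 0; apply: eq_integrable => // z _.
  by congr EFin; ring.
have i2 : mu.-integrable setT (fun z => (2 * a * b * (z * gauss v z))%:E).
  have := integrable_gauss_poly2 0 (2 * a * b) 0; apply: eq_integrable => // z _.
  by congr EFin; ring.
have i3 : mu.-integrable setT (fun z => (b ^+ 2 * (z ^+ 2 * gauss v z))%:E).
  have := integrable_gauss_poly2 0 0 (b ^+ 2); apply: eq_integrable => // z _.
  by congr EFin; ring.
have i12 : mu.-integrable setT
    (fun z => (a ^+ 2 * gauss v z + 2 * a * b * (z * gauss v z))%:E).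
  have := integrable_gauss_poly2 (a ^+ 2) (2 * a * b) 0; apply: eq_integrable => // z _.
  by congr EFin; ring.
transitivity (\int[mu]_z (a ^+ 2 * gauss v z + 2 * a * b * (z * gauss v z)
    + b ^+ 2 * (z ^+ 2 * gauss v z)))%R%:E; last first.
  congr EFin; rewrite !RintegralD // !RintegralZl //.
  + rewrite Rintegral_id_gauss Rintegral_sqr_gauss {1}/Rintegral integral_gauss /=; ring.
  + exact: integrable_sqr_gauss.
  + exact: integrable_id_gauss.
  + exact: integrable_gauss.
rewrite /Rintegral fineK.
  by apply: eq_integral => z _; congr EFin; ring.
apply: integrable_fin_num => //.
have := integrable_gauss_poly2 (a ^+ 2) (2 * a * b) (b ^+ 2); apply: eq_integrable => // z _.
by congr EFin; ring.
Qed.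
End gaussian_moments.

(** * Estimation cost of a general control, and optimality of the posterior mean *)

Section estimation_cost.
Context {R : realType}.
Local Notation mu := (@lebesgue_measure R).
Implicit Types m : R -> R.
Variables (Q N : R) (Q0 : 0 < Q) (N0 : 0 < N) (gamma : R -> R).
Hypothesis mgamma : measurable_fun setT gamma.
Hypothesis gamma_growth : exp_growth setT (fun _ => gamma).

Local Notation X1 := (state1 gamma).

Lemma measurable_state1 : measurable_fun setT X1.
Proof. exact: measurable_funD. Qed.

Lemma state1_growth : exp_growth setT (fun _ => X1).
Proof. by apply: exp_growthD => //; exact: exp_growth_snd. Qed.

(** Uses the coordinates [x0] and [y] instead of [x0] and [z], with extended real values, so that
    Tonelli applies by measurability and nonnegativity. *)
Definition joint_cost (m : R -> R) (w : R * R) : \bar R :=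
  ((X1 w.1 - m w.2) ^+ 2 * gauss N (w.2 - X1 w.1) * gauss Q w.1)%:E.

Lemma joint_cost_ge0 m w : (0 <= joint_cost m w)%E.
Proof.
by rewrite /joint_cost lee_fin mulr_ge0 ?gauss_ge0 // mulr_ge0 ?gauss_ge0 // sqr_ge0.
Qed.

Lemma measurable_joint_cost m : measurable_fun setT m ->
  measurable_fun [set: R * R] (joint_cost m).
Proof.
move=> mm; apply/measurable_EFinP.
have mX : measurable_fun [set: R * R] (fun w : R * R => X1 w.1).
  exact: (measurableT_comp measurable_state1).
apply: measurable_funM; first apply: measurable_funM.
- apply: measurable_funX; apply: measurable_funB => //.
  exact: (measurableT_comp mm).
- apply: (measurableT_comp (measurable_gauss N)).
  exact: measurable_funB.
- exact: (measurableT_comp (measurable_gauss Q)).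
Qed.

Lemma tonelli_joint_cost m : measurable_fun setT m ->
  (\int[mu]_x \int[mu]_y joint_cost m (x, y)
   = \int[mu]_y \int[mu]_x joint_cost m (x, y))%E.
Proof.
move=> mm.
exact: (@fubini_tonelli _ _ (measurableTypeR R) (measurableTypeR R) R mu mu (joint_cost m) (measurable_joint_cost m mm)
  (joint_cost_ge0 m)).
Qed.

Lemma est_cost_inner m x1 : measurable_fun setT m ->
  (\int[mu]_z ((x1 - m (x1 + z)) ^+ 2 * gauss N z)%:E
   = \int[mu]_y ((x1 - m y) ^+ 2 * gauss N (y - x1))%:E)%E.
Proof.
move=> mm; rewrite [RHS](ge0_integral_shift x1).
- by apply: eq_integral => z _; rewrite addrK (addrC z).
- apply/measurable_EFinP/measurable_funM.
    by apply: measurable_funX; exact: measurable_funB.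
  by apply: (measurableT_comp (measurable_gauss N)); exact: measurable_funB.
- by move=> y; rewrite lee_fin mulr_ge0 ?gauss_ge0 // sqr_ge0.
Qed.

Definition second_moment : R := \int[mu]_x (X1 x ^+ 2 * gauss Q x).

Lemma integrable_second_moment : mu.-integrable setT (fun x => (X1 x ^+ 2 * gauss Q x)%:E).
Proof.
apply: (integrable_exp_growth Q setT (fun _ x => X1 x ^+ 2) 0) => //.
  by apply: measurable_funX; exact: measurable_state1.
exact: exp_growthX state1_growth.
Qed.

Lemma integral_joint_cost_inner m x : measurable_fun setT m ->
  (\int[mu]_y joint_cost m (x, y)
   = \int[mu]_z ((X1 x - m (X1 x + z)) ^+ 2 * gauss N z)%:E * (gauss Q x)%:E)%E.
Proof.
move=> mm; rewrite est_cost_inner // -ge0_integralZr //.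
- apply/measurable_EFinP/measurable_funM.
    by apply: measurable_funX; exact: measurable_funB.
  by apply: (measurableT_comp (measurable_gauss N)); exact: measurable_funB.
- by move=> y _; rewrite lee_fin mulr_ge0 ?gauss_ge0 // sqr_ge0.
- by rewrite lee_fin gauss_ge0.
Qed.

(** The error of the estimator [c * y] is [(1 - c) * X1 - c * Z1], with [Z1] centred and independent
    of [X1]. *)
Lemma integral_joint_cost_linear c :
  (\int[mu]_x \int[mu]_y joint_cost (fun y => (c * y)%R) (x, y)
   = ((1 - c) ^+ 2 * second_moment + c ^+ 2 * N)%:E)%E.
Proof.
have mc : measurable_fun [set: R] (fun y => c * y) by exact: measurable_funM.
have i2 := integrable_second_moment; have i0 := integrable_gauss Q.
have j2 : mu.-integrable setT (fun x => ((1 - c) ^+ 2 * (X1 x ^+ 2 * gauss Q x))%:E).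
  exact: integrableZl_EFin.
have j0 : mu.-integrable setT (fun x => (c ^+ 2 * N * gauss Q x)%:E).
  exact: integrableZl_EFin.
transitivity (\int[mu]_x ((1 - c) ^+ 2 * (X1 x ^+ 2 * gauss Q x)
    + c ^+ 2 * N * gauss Q x))%:E; last first.
  rewrite RintegralD // !RintegralZl //.
  by rewrite [X in _ + _ * X]/Rintegral integral_gauss mulr1.
rewrite /Rintegral fineK; last first.
  by apply: integrable_fin_num => //; exact: integrableD_EFin j2 j0.
apply: eq_integral => x _; rewrite integral_joint_cost_inner //.
have -> : (\int[mu]_z ((X1 x - c * (X1 x + z)) ^+ 2 * gauss N z)%:E
    = \int[mu]_z (((1 - c) * X1 x + (- c) * z) ^+ 2 * gauss N z)%:E)%E.
  by apply: eq_integral => z _; congr EFin; ring.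
rewrite integral_sqr_affine_gauss // -EFinM; congr EFin; ring.
Qed.

(** [est_cost] nests real-valued integrals while Tonelli lives in the extended reals; the two agree
    because the inner integral is finite, by the growth of [m]. *)
Lemma est_cost_joint m : measurable_fun setT m -> exp_growth setT (fun _ => m) ->
  mmse_est Q N gamma = m ->
  est_cost Q N gamma = fine (\int[mu]_y \int[mu]_x joint_cost m (x, y))%E.
Proof.
move=> mm mgr mE; rewrite -tonelli_joint_cost // /est_cost mE.
congr fine; apply: eq_integral => x _; rewrite integral_joint_cost_inner //.
rewrite EFinM; congr (_ * _)%E; rewrite /Rintegral fineK //.
apply: integrable_fin_num => //.
apply: (integrable_exp_growth N setT (fun _ z => (X1 x - m (X1 x + z)) ^+ 2) 0) => //.
  apply: measurable_funX; apply: measurable_funB => //.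
  by apply: (measurableT_comp mm); exact: measurable_funD.
apply: exp_growthX; apply: exp_growthB; first exact: exp_growth_cst.
have [C [b [C0 b0 mC]]] := mgr.
(* Here [x] is fixed, and [|X1 x + z| <= |X1 x| + |z|]: the shift only multiplies the constant. *)
exists (C * expR (b * `|X1 x|)), b; split => //; first by rewrite mulr_ge0 ?expR_ge0.
move=> _ z _; rewrite (le_trans (mC 0 _ I)) // -mulrA ler_wpM2l // -expRD ler_expR.
by rewrite -mulrDr ler_wpM2l // ler_normD.
Qed.

(** [h] and [g] are the second and first posterior moments of [X1] given [Y1 = y], multiplied by the
    density of [Y1]. *)
Let h y : R := \int[mu]_x (X1 x ^+ 2 * gauss N (y - X1 x) * gauss Q x).
Let g y : R := \int[mu]_x (X1 x * gauss N (y - X1 x) * gauss Q x).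

Lemma integrable_likelihood n y :
  mu.-integrable setT (fun x => (X1 x ^+ n * gauss N (y - X1 x) * gauss Q x)%:E).
Proof.
apply: (integrable_exp_growth Q setT (fun _ x => X1 x ^+ n * gauss N (y - X1 x)) 0) => //.
  apply: measurable_funM; first exact: measurable_funX measurable_state1.
  apply: (measurableT_comp (measurable_gauss N)); apply: measurable_funB => //.
  exact: measurable_state1.
apply: exp_growthM; first exact: exp_growthX state1_growth.
apply: (@exp_growth_bounded _ _ _ (peak N)) => _ x _.
by rewrite ger0_norm ?gauss_ge0 // gauss_le_peak.
Qed.

(** The inner cost is quadratic in [m y], with unnormalised posterior moments as coefficients. Both
    the optimality of the posterior mean and the formula for its cost come from here. *)
Lemma integral_joint_cost_posterior m y :
  (\int[mu]_x joint_cost m (x, y)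
   = (h y - 2 * m y * g y + m y ^+ 2 * ydens Q N gamma y)%:E)%E.
Proof.
have i2 := integrable_likelihood 2 y.
have i1 := integrable_likelihood 1 y.
have i0 := integrable_likelihood 0 y.
have i1' : mu.-integrable setT (fun x => (X1 x * gauss N (y - X1 x) * gauss Q x)%:E).
  by move: i1; apply: eq_integrable => // x _; rewrite expr1.
have i0' : mu.-integrable setT (fun x => (gauss N (y - X1 x) * gauss Q x)%:E).
  by move: i0; apply: eq_integrable => // x _; rewrite expr0 mul1r.
have i1z : mu.-integrable setT
    (fun x => (2 * m y * (X1 x * gauss N (y - X1 x) * gauss Q x))%:E).
  exact: integrableZl_EFin.
have i0z : mu.-integrable setT
    (fun x => (m y ^+ 2 * (gauss N (y - X1 x) * gauss Q x))%:E).
  exact: integrableZl_EFin.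
have i21 : mu.-integrable setT (fun x => (X1 x ^+ 2 * gauss N (y - X1 x) * gauss Q x
   - 2 * m y * (X1 x * gauss N (y - X1 x) * gauss Q x))%:E).
  exact: integrableB_EFin i2 i1z.
transitivity (\int[mu]_x (X1 x ^+ 2 * gauss N (y - X1 x) * gauss Q x
   - 2 * m y * (X1 x * gauss N (y - X1 x) * gauss Q x)
   + m y ^+ 2 * (gauss N (y - X1 x) * gauss Q x)))%:E; last first.
  by rewrite RintegralD // RintegralB // !RintegralZl.
rewrite /Rintegral fineK.
  by apply: eq_integral => x _; rewrite /joint_cost /=; congr EFin; ring.
apply: integrable_fin_num => //; exact: integrableD_EFin i21 i0z.
Qed.

Hypothesis ydens_gt0 : forall y, 0 < ydens Q N gamma y.

Let m := mmse_est Q N gamma.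
Hypothesis mm : measurable_fun setT m.
Hypothesis m_growth : exp_growth setT (fun _ => m).

Let mydens y : m y * ydens Q N gamma y = g y.
Proof. by rewrite /m /mmse_est mulfVK // gt_eqF. Qed.

Let posterior_var y : h y - 2 * m y * g y + m y ^+ 2 * ydens Q N gamma y
  = h y - m y ^+ 2 * ydens Q N gamma y.
Proof. rewrite -mydens; ring. Qed.

Lemma measurable_inner_cost (m' : R -> R) : measurable_fun setT m' ->
  measurable_fun setT (fun y => \int[mu]_x joint_cost m' (x, y))%E.
Proof.
move=> mm'.
exact: (@measurable_fun_fubini_tonelli_G _ _ (measurableTypeR R) (measurableTypeR R)
  R mu _ (measurable_joint_cost _ mm') (joint_cost_ge0 _)).
Qed.

Lemma inner_cost_ge0 (m' : R -> R) y : (0 <= \int[mu]_x joint_cost m' (x, y))%E.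
Proof. by apply: integral_ge0 => x _; exact: joint_cost_ge0. Qed.

(** At each [y] the inner cost of [c * y] exceeds that of the posterior mean by
    [ydens * (c * y - m y) ^+ 2]. *)
Lemma est_cost_le_linear c :
  est_cost Q N gamma <= (1 - c) ^+ 2 * second_moment + c ^+ 2 * N.
Proof.
have mc : measurable_fun [set: R] (fun y => c * y) by exact: measurable_funM.
have le_mc : (\int[mu]_y \int[mu]_x joint_cost m (x, y) <=
    ((1 - c) ^+ 2 * second_moment + c ^+ 2 * N)%:E)%E.
  have := integral_joint_cost_linear c; rewrite tonelli_joint_cost // => <-.
  apply: ge0_le_integral => //.
  - by move=> y _; exact: inner_cost_ge0.
  - exact: measurable_inner_cost.
  - exact: measurable_inner_cost.
  - move=> y _; rewrite !integral_joint_cost_posterior lee_fin posterior_var -subr_ge0.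
    rewrite (_ : _ - _ = ydens Q N gamma y * (c * y - m y) ^+ 2); last first.
      rewrite -mydens; ring.
    by rewrite mulr_ge0 ?sqr_ge0 // ltW.
rewrite (est_cost_joint m) // -lee_fin fineK //.
rewrite ge0_fin_numE; first exact: le_lt_trans le_mc (ltry _).
by apply: integral_ge0 => y _; exact: inner_cost_ge0.
Qed.

Lemma est_cost_eq_linear c : (forall y, m y = c * y) ->
  est_cost Q N gamma = (1 - c) ^+ 2 * second_moment + c ^+ 2 * N.
Proof.
move=> mc; rewrite (est_cost_joint m) // -tonelli_joint_cost //.
by rewrite (_ : m = (fun y => c * y)) ?integral_joint_cost_linear //; exact/funext.
Qed.

Hypothesis mydens_meas : measurable_fun setT (ydens Q N gamma).

(** The zero estimator has inner cost [h], so [h] integrates to [second_moment]. Nonnegativity of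
    the posterior variance bounds [m ^+ 2 * ydens] by [h], so the integral of their difference
    splits. *)
Lemma est_costE :
  est_cost Q N gamma = second_moment - \int[mu]_y (m y ^+ 2 * ydens Q N gamma y).
Proof.
have inner0 y : (\int[mu]_x joint_cost (fun y => 0 * y)%R (x, y) = (h y)%:E)%E.
  by rewrite integral_joint_cost_posterior; congr EFin; ring.
have m0 : measurable_fun [set: R] (fun y : R => 0 * y) by exact: measurable_funM.
have mh : measurable_fun setT h.
  apply/measurable_EFinP; rewrite (_ : _ \o _ =
    (fun y => \int[mu]_x joint_cost (fun y => 0 * y)%R (x, y))%E); last first.
    by apply/funext => y; rewrite inner0.
  exact: measurable_inner_cost.
have h0 y : 0 <= h y by rewrite -lee_fin -inner0; exact: inner_cost_ge0.
have intH : (\int[mu]_y (h y)%:E = second_moment%:E)%E.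
  have := integral_joint_cost_linear 0; rewrite tonelli_joint_cost // => H.
  transitivity (\int[mu]_y \int[mu]_x joint_cost (fun y => 0 * y)%R (x, y))%E.
    by apply: eq_integral => y _; rewrite inner0.
  by rewrite H; congr EFin; ring.
have ih : mu.-integrable setT (fun y => (h y)%:E).
  apply/integrableP; split; first exact/measurable_EFinP.
  under eq_integral do rewrite gee0_abs ?lee_fin //.
  by rewrite intH ltry.
have im : mu.-integrable setT (fun y => (m y ^+ 2 * ydens Q N gamma y)%:E).
  apply: (@le_integrable _ _ _ mu _ measurableT _ (fun y => (h y)%:E)) => //.
    by apply/measurable_EFinP/measurable_funM => //; exact: measurable_funX.
  move=> y _; rewrite /= lee_fin !ger0_norm //; last first.
    by rewrite mulr_ge0 ?sqr_ge0 // ltW.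
  rewrite -subr_ge0 -posterior_var -lee_fin -integral_joint_cost_posterior.
  exact: inner_cost_ge0.
rewrite (est_cost_joint m) //.
transitivity (\int[mu]_y (h y - m y ^+ 2 * ydens Q N gamma y)).
  congr fine; apply: eq_integral => y _.
  by rewrite integral_joint_cost_posterior posterior_var.
rewrite RintegralB //; congr (_ - _).
by rewrite /Rintegral intH.
Qed.

End estimation_cost.

(** * Closed forms for the BPSK observation density and MMSE estimator *)

Section bpsk_closed_form.
Context {R : realType}.
Local Notation mu := (@lebesgue_measure R).
Variables (Q N : R) (Q0 : 0 < Q) (N0 : 0 < N).
Implicit Types a x y t : R.

Let V := Q + N.
Let k := Q / V.
Let v := Q * N / V.

Let V0 : 0 < V. Proof. exact: addr_gt0. Qed.
Let v0 : 0 < v. Proof. by rewrite divr_gt0 ?mulr_gt0. Qed.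

Lemma measurable_bpsk a : measurable_fun setT (bpsk a).
Proof.
apply: measurable_funM => //.
have -> : Num.sg = (fun x : R => \1_(`]0, +oo[ : set R) x - \1_(`]-oo, 0[ : set R) x).
  apply/funext => x; rewrite !indicE !mem_setE !in_itv /= andbT.
  by case: (ltgtP x 0) => [x0|x0|->]; rewrite ?sgr0 ?(ltr0_sg x0) ?(gtr0_sg x0) ?subr0 ?sub0r.
by apply: measurable_funB; exact: measurable_indic.
Qed.

Lemma bpsk_growth a : exp_growth setT (fun _ => bpsk a).
Proof.
apply: (@exp_growth_bounded _ _ _ `|a|) => _ x _; rewrite normrM normrN ler_piMr //.
by rewrite normr_sg lern1; case: (_ == _).
Qed.

Lemma state1_bpsk_gt0 a x : 0 < x -> state1 (bpsk a) x = x - a.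
Proof. by move=> x0; rewrite /state1 /bpsk gtr0_sg // mulr1. Qed.

Lemma state1_bpskN a x : 0 < x -> state1 (bpsk a) (- x) = a - x.
Proof. by move=> x0; rewrite /state1 /bpsk sgrN gtr0_sg // mulrN1 opprK addrC. Qed.

(** [gcdf v (k * t)] is the posterior probability of [X0 > 0] given [X0 + Z1 = t]. It is used at
    [t = y + a] and [t = - y + a]. *)
Lemma Rintegral_gt0_likelihood t :
  \int[mu]_(x in `]0, +oo[) (gauss N (t - x) * gauss Q x) = gauss V t * gcdf v (k * t).
Proof.
under eq_Rintegral do rewrite gauss_mul //.
rewrite RintegralZl; [|by []|]; last first.
  by apply: (@integrableS _ _ _ _ setT) => //; exact: integrable_gauss_center.
by rewrite Rintegral_gt0_gauss.
Qed.

Lemma Rintegral_gt0_id_likelihood t :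
  \int[mu]_(x in `]0, +oo[) (x * (gauss N (t - x) * gauss Q x))
  = gauss V t * gmean v (k * t).
Proof.
under eq_Rintegral do rewrite gauss_mul // mulrCA.
rewrite RintegralZl; [|by []|]; last first.
  by apply: (@integrableS _ _ _ _ setT) => //; exact: integrable_shift_gauss.
by rewrite Rintegral_gt0_id_gauss.
Qed.

Let integrable_moment_likelihood n t :
  mu.-integrable setT (fun x => (x ^+ n * (gauss N (t - x) * gauss Q x))%:E).
Proof.
(* Under the zero control [state1] is the identity, so the general integrability result covers the
   plain moments. *)
have mc : measurable_fun setT (cst 0 : R -> R) by exact: measurable_cst.
have := integrable_likelihood Q N Q0 N0 (cst 0) mc (exp_growth_cst _ 0) n t.
by apply: eq_integrable => // x _; rewrite /state1 addr0 mulrA.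
Qed.

Let integrable_likelihood0 t :
  mu.-integrable setT (fun x => (gauss N (t - x) * gauss Q x)%:E).
Proof.
have := integrable_moment_likelihood 0 t.
by apply: eq_integrable => // x _; rewrite expr0 mul1r.
Qed.

Let integrable_id_likelihood t :
  mu.-integrable setT (fun x => (x * (gauss N (t - x) * gauss Q x))%:E).
Proof.
have := integrable_moment_likelihood 1 t.
by apply: eq_integrable => // x _; rewrite expr1.
Qed.

Let integrable_state_likelihood a t :
  mu.-integrable setT (fun x => ((x - a) * (gauss N (t - x) * gauss Q x))%:E).
Proof.
have := integrableB_EFin (integrable_id_likelihood t)
  (integrableZl_EFin a _ (integrable_likelihood0 t)).
by apply: eq_integrable => // x _; rewrite mulrBl.
Qed.

Lemma Rintegral_gt0_state_likelihood a t :
  \int[mu]_(x in `]0, +oo[) ((x - a) * (gauss N (t - x) * gauss Q x))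
  = gauss V t * (gmean v (k * t) - a * gcdf v (k * t)).
Proof.
under eq_Rintegral do rewrite mulrBl.
rewrite RintegralB; [|by []| |]; last 2 first.
- by apply: (@integrableS _ _ _ _ setT) => //; exact: integrable_id_likelihood.
- by apply: (@integrableS _ _ _ _ setT) => //; exact: (integrableZl_EFin a _ (integrable_likelihood0 t)).
rewrite RintegralZl; [|by []|]; last first.
  by apply: (@integrableS _ _ _ _ setT) => //; exact: integrable_likelihood0.
by rewrite Rintegral_gt0_likelihood Rintegral_gt0_id_likelihood; ring.
Qed.

(* Contributions of the event [X0 > 0] to the density of [Y1] at [y] and to the
   numerator of the MMSE estimator, both divided by
   [gauss V y * expR (- (a ^+ 2 / (2 * V)))]; those of [X0 < 0] follow by [y -> - y]. *)
Definition likelihood_ratio a y : R := expR (- (y * a / V)) * gcdf v (k * (y + a)).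
Definition mean_ratio a y : R :=
  expR (- (y * a / V)) * (gmean v (k * (y + a)) - a * gcdf v (k * (y + a))).
Definition bpsk_den a y := likelihood_ratio a y + likelihood_ratio a (- y).
Definition bpsk_num a y := mean_ratio a y - mean_ratio a (- y).

(** On [X0 > 0], [Y1 + a] is the uncontrolled observation; the half [X0 < 0] is its mirror image
    under [y -> - y]. [gaussD] then extracts the common weight. *)
Lemma ydens_bpsk a y :
  ydens Q N (bpsk a) y = gauss V y * expR (- (a ^+ 2 / (2 * V))) * bpsk_den a y.
Proof.
rewrite /ydens Rintegral_half; last first.
  have := integrable_likelihood Q N Q0 N0 (bpsk a) (measurable_bpsk a) (bpsk_growth a) 0 y.
  by apply: eq_integrable => // x _; rewrite expr0 mul1r.
have -> : \int[mu]_(x in `]0, +oo[) (gauss N (y - state1 (bpsk a) x) * gauss Q x)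
    = gauss V (y + a) * gcdf v (k * (y + a)).
  rewrite -Rintegral_gt0_likelihood; apply: eq_Rintegral => x.
  rewrite inE /= in_itv /= andbT => x0.
  by rewrite state1_bpsk_gt0 // opprB addrA.
have -> : \int[mu]_(x in `]0, +oo[) (gauss N (y - state1 (bpsk a) (- x)) * gauss Q (- x))
    = gauss V (- y + a) * gcdf v (k * (- y + a)).
  rewrite -Rintegral_gt0_likelihood; apply: eq_Rintegral => x.
  rewrite inE /= in_itv /= andbT => x0.
  rewrite state1_bpskN // gaussN // -[in LHS](gaussN N) //.
  by congr (gauss _ _ * _); ring.
by rewrite !gaussD // gaussN // /bpsk_den /likelihood_ratio; ring.
Qed.

(** The same splitting as for the density; reflection changes the sign of [X1], whence a difference
    where the density has a sum. *)
Lemma mmse_numerator_bpsk a y :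
  \int[mu]_x (state1 (bpsk a) x * gauss N (y - state1 (bpsk a) x) * gauss Q x)
  = gauss V y * expR (- (a ^+ 2 / (2 * V))) * bpsk_num a y.
Proof.
rewrite Rintegral_half; last first.
  have := integrable_likelihood Q N Q0 N0 (bpsk a) (measurable_bpsk a) (bpsk_growth a) 1 y.
  by apply: eq_integrable => // x _; rewrite expr1.
have -> : \int[mu]_(x in `]0, +oo[)
      (state1 (bpsk a) x * gauss N (y - state1 (bpsk a) x) * gauss Q x)
    = gauss V (y + a) * (gmean v (k * (y + a)) - a * gcdf v (k * (y + a))).
  rewrite -Rintegral_gt0_state_likelihood; apply: eq_Rintegral => x.
  rewrite inE /= in_itv /= andbT => x0.
  by rewrite state1_bpsk_gt0 // opprB addrA mulrA.
have -> : \int[mu]_(x in `]0, +oo[)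
      (state1 (bpsk a) (- x) * gauss N (y - state1 (bpsk a) (- x)) * gauss Q (- x))
    = - (gauss V (- y + a) * (gmean v (k * (- y + a)) - a * gcdf v (k * (- y + a)))).
  rewrite -Rintegral_gt0_state_likelihood -mulN1r -RintegralZl //; last first.
    by apply: (@integrableS _ _ _ _ setT) => //; exact: integrable_state_likelihood.
  apply: eq_Rintegral => x.
  rewrite inE /= in_itv /= andbT => x0.
  rewrite state1_bpskN // gaussN // -[in LHS](gaussN N) //.
  rewrite (_ : - (y - (a - x)) = - y + a - x); ring.
by rewrite !gaussD // gaussN // /bpsk_num /mean_ratio; ring.
Qed.

Lemma bpsk_den_gt0 a y : 0 < bpsk_den a y.
Proof. by rewrite addr_gt0 // mulr_gt0 ?expR_gt0 // gcdf_gt0. Qed.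

Lemma mmse_est_bpsk a y : mmse_est Q N (bpsk a) y = bpsk_num a y / bpsk_den a y.
Proof.
rewrite /mmse_est mmse_numerator_bpsk ydens_bpsk.
by field; rewrite !gt_eqF ?mulr_gt0 ?expR_gt0 ?gauss_gt0 ?bpsk_den_gt0.
Qed.
End bpsk_closed_form.

(** * Differentiation under a Gaussian integral *)

Section tame.
Context {R : realType}.
Local Notation mu := (@lebesgue_measure R).
Local Notation I := (`]-1, 1[%classic : set R).
Implicit Types f g : R -> R -> R.

(* A class closed under the ring operations, on which the integral of [f a] against
   a Gaussian density can be differentiated in [a] under the integral sign. *)
Definition tame f := [/\ exp_growth I f, (forall a, continuous (f a))
  & forall y, continuous (f ^~ y)].

Lemma tame_measurable f a : tame f -> measurable_fun setT (f a).
Proof. by move=> [_ cf _]; exact: continuous_measurable_fun. Qed.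

Lemma tame_cst (c : R) : tame (fun _ _ => c).
Proof. by split=> [|a|y]; [exact: exp_growth_cst|exact: cst_continuous..]. Qed.

Lemma tame_snd : tame (fun _ y => y).
Proof.
split=> [|a y|y]; [exact: exp_growth_snd|exact: cvg_id|exact: cst_continuous].
Qed.

Lemma tame_bounded_fst (h : R -> R) : continuous h -> (forall a, I a -> `|h a| <= 1) ->
  tame (fun a _ => h a).
Proof.
move=> ch h1; split=> [|a|//]; last exact: cst_continuous.
by apply: (@exp_growth_bounded _ _ _ 1) => a _; exact: h1.
Qed.

Lemma tame_fst : tame (fun a _ => a).
Proof.
apply: (tame_bounded_fst idfun) => [a|a]; first exact: cvg_id.
by rewrite /= in_itv /= => /andP[? ?]; rewrite ler_norml; lra.
Qed.

Lemma tameD f g : tame f -> tame g -> tame (fun a y => f a y + g a y).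
Proof.
move=> [ef mf cf] [eg mg cg]; split=> [|a|y].
- exact: exp_growthD.
- by move=> y; apply: (@cvgD _ R^o); [exact: mf|exact: mg].
- by move=> a; apply: (@cvgD _ R^o); [exact: cf|exact: cg].
Qed.

Lemma tameM f g : tame f -> tame g -> tame (fun a y => f a y * g a y).
Proof.
move=> [ef mf cf] [eg mg cg]; split=> [|a|y].
- exact: exp_growthM.
- by move=> y; apply: cvgM; [exact: mf|exact: mg].
- by move=> a; apply: cvgM; [exact: cf|exact: cg].
Qed.

Lemma tameN f : tame f -> tame (fun a y => - f a y).
Proof.
move=> [ef mf cf]; split=> [|a|y].
- exact: exp_growthN.
- by move=> y; apply: (@cvgN _ R^o); exact: mf.
- by move=> a; apply: (@cvgN _ R^o); exact: cf.
Qed.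

Lemma tameB f g : tame f -> tame g -> tame (fun a y => f a y - g a y).
Proof. by move=> tf tg; apply: tameD => //; exact: tameN. Qed.

Lemma tameX f n : tame f -> tame (fun a y => f a y ^+ n).
Proof.
move=> [ef mf cf]; split=> [|a|y].
- exact: exp_growthX.
- by move=> y; apply: (@continuous_comp _ _ _ (f a) (fun z => z ^+ n)); [exact: mf|exact: exprn_continuous].
- by move=> a; apply: (@continuous_comp _ _ _ (f ^~ y) (fun z => z ^+ n)); [exact: cf|exact: exprn_continuous].
Qed.

Lemma tameN_snd f : tame f -> tame (fun a y => f a (- y)).
Proof.
move=> [ef mf cf]; split=> [|a|y].
- exact: exp_growthN_snd.
- move=> y; apply: continuous_comp; last exact: mf.
  exact: (@cvgN _ R^o _ _ _ _ _ cvg_id).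
- exact: cf.
Qed.

Lemma tameV f c d : 0 < c -> (forall a y, f a y != 0) ->
  (forall a y, I a -> c * expR (- d * `|y|) <= f a y) ->
  tame f -> tame (fun a y => (f a y)^-1).
Proof.
move=> c0 f0 fc [ef mf cf]; split=> [|a|y].
- exact: exp_growthV fc.
- by move=> y; apply: cvgV; [exact: f0|exact: mf].
- by move=> a; apply: cvgV; [exact: f0|exact: cf].
Qed.

Lemma tame_affine (h : R -> R) (k C : R) : continuous h -> (forall s, `|h s| <= C) ->
  tame (fun a y => h (k * (y + a))).
Proof.
move=> ch hC; split=> [|a y|y a].
- exact: (@exp_growth_bounded _ _ _ C).
- apply: continuous_comp; last exact: ch.
  apply: cvgM; first exact: cvg_cst.
  by apply: (@cvgD _ R^o); [exact: cvg_id|exact: cvg_cst].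
- apply: continuous_comp; last exact: ch.
  apply: cvgM; first exact: cvg_cst.
  by apply: (@cvgD _ R^o); [exact: cvg_cst|exact: cvg_id].
Qed.

(** Boundedness of the parameter interval enters here: [|a| < 1] bounds the exponent by [|y| / V]
    uniformly in [a]. *)
Lemma tame_expR (V : R) : 0 < V -> tame (fun a y => expR (- (y * a / V))).
Proof.
move=> V0; split=> [|a y|y a].
- apply: (@exp_growth_expR _ _ _ V^-1) => a y; rewrite /= in_itv /= => /andP[a1 a2].
  rewrite normrN !normrM normfV (gtr0_norm V0) mulrC ler_pM2l ?invr_gt0 //.
  by rewrite ler_piMr // ler_norml; lra.
- apply: continuous_comp; last exact: continuous_expR.
  apply: (@cvgN _ R^o); apply: cvgM; last exact: cvg_cst.
  by apply: cvgM; [exact: cvg_id|exact: cvg_cst].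
- apply: continuous_comp; last exact: continuous_expR.
  apply: (@cvgN _ R^o); apply: cvgM; last exact: cvg_cst.
  by apply: cvgM; [exact: cvg_cst|exact: cvg_id].
Qed.

Variables (v : R) (v0 : 0 < v).

Lemma tame_integrable f a : I a -> tame f ->
  mu.-integrable setT (fun y => (f a y * gauss v y)%:E).
Proof.
move=> Ia tf; have [ef _ _] := tf.
by apply: (integrable_exp_growth v I) => //; exact: tame_measurable.
Qed.

(** One integrable majorant serves the whole interval, as continuity and differentiation under the
    integral both demand. *)
Lemma exp_growth_dominated f : exp_growth I f -> exists2 g : R -> R,
  mu.-integrable setT (EFin \o g) &
  forall a y, I a -> `|f a y * gauss v y| <= g y.
Proof.
move=> [C [b [C0 b0 fC]]].
exists (fun y => C * expR (b * `|y|) * gauss v y); last first.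
  move=> a y Ia; rewrite normrM (ger0_norm (gauss_ge0 v y v0)).
  by rewrite ler_wpM2r ?gauss_ge0 // fC.
apply: (integrable_exp_growth v setT (fun _ y => C * expR (b * `|y|)) 0) => //.
  apply: measurable_funM => //; apply: measurableT_comp => //.
  by apply: measurable_funM => //; exact: measurableT_comp.
apply: exp_growthM; first exact: exp_growth_cst.
by apply: (@exp_growth_expR _ _ _ b) => a y _; rewrite normrM normr_id (ger0_norm b0).
Qed.

Lemma tame_continuous_integral f : tame f ->
  {in I, continuous (fun a => \int[mu]_y (f a y * gauss v y))}.
Proof.
move=> tf; have [ef mf cf] := tf; have [g ig fg] := exp_growth_dominated f ef.
apply: (@continuity_under_integral _ _ (measurableTypeR R) mu
  (fun a y => f a y * gauss v y) setT measurableT (-1) 1 _ _ g ig).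
- by move=> a Ia; exact: tame_integrable.
- apply: aeW => y _ a _; apply: cvgM; [exact: cf|exact: cvg_cst].
- by move=> a Ia; apply: aeW => y _; exact: fg.
Qed.

Lemma tame_derive_integral f df a : tame f -> tame df ->
  (forall (b : R) y, is_derive b 1 (f ^~ y) (df b y)) -> I a ->
  is_derive a 1 (fun a => \int[mu]_y (f a y * gauss v y))
    (\int[mu]_y (df a y * gauss v y)).
Proof.
move=> tf tdf dE Ia; have [edf _ _] := tdf.
have [g ig dg] := exp_growth_dominated df edf.
have dfg (b : R) y : is_derive b 1 (fun a => f a y * gauss v y) (df b y * gauss v y).
  have := dE b y => H; apply: is_derive_eq; rewrite /GRing.scale /=.
  by rewrite mulr0 add0r mulrC.
have g0 y : 0 <= g y by apply: le_trans (dg a y Ia).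
have d1 b y : partial1of2 (fun a y => f a y * gauss v y) b y = df b y * gauss v y.
  by rewrite partial1of2E; exact: derive_val.
have int1 b : I b -> mu.-integrable setT (EFin \o (fun y => f b y * gauss v y)).
  by move=> Ib; exact: tame_integrable.
have der1 b y : I b -> [set: R] y -> derivable (fun a => f a y * gauss v y) b 1.
  by move=> _ _; exact: ex_derive.
have ub b y : I b -> [set: R] y ->
    `|partial1of2 (fun a y => f a y * gauss v y) b y| <= g y.
  by move=> Ib _; rewrite d1; exact: dg.
split.
  exact: (@derivable_under_integral _ _ (measurableTypeR R) mu _ setT measurableT
    a (-1) 1 Ia int1 der1 g g0 ig ub).
rewrite -derive1E (@differentiation_under_integral _ _ (measurableTypeR R) mu _ setT
  measurableT a (-1) 1 Ia int1 der1 g g0 ig ub).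
by apply: eq_Rintegral => y _; rewrite d1.
Qed.
End tame.

(** * Regularity in [a] of the second moment of the BPSK estimate *)

Section bpsk_derivative.
Context {R : realType}.
Local Notation mu := (@lebesgue_measure R).
Local Notation I := (`]-1, 1[%classic : set R).
Variables (Q N : R) (Q0 : 0 < Q) (N0 : 0 < N).
Implicit Types a x y t : R.

Let V := Q + N.
Let k := Q / V.
Let v := Q * N / V.

Let V0 : 0 < V. Proof. exact: addr_gt0. Qed.
Let v0 : 0 < v. Proof. by rewrite divr_gt0 ?mulr_gt0. Qed.
Let k0 : 0 < k. Proof. by rewrite divr_gt0. Qed.

Let tame_gcdf : tame (fun a y => gcdf v (k * (y + a))).
Proof.
apply: (tame_affine (gcdf v) k 1); first exact: continuous_gcdf.
by move=> s; rewrite ger0_norm ?gcdf_ge0 // gcdf_le1.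
Qed.

Let tame_gauss : tame (fun a y => gauss v (k * (y + a))).
Proof.
apply: (tame_affine (gauss v) k (peak v)); first exact: continuous_gauss.
by move=> s; rewrite ger0_norm ?gauss_ge0 // gauss_le_peak.
Qed.

Let tame_gmean : tame (fun a y => gmean v (k * (y + a))).
Proof.
apply: tameD; first by apply: tameM => //; exact: tame_cst.
apply: tameM => //; apply: tameM; first exact: tame_cst.
by apply: tameD; [exact: tame_snd|exact: tame_fst].
Qed.

Let tame_yV : tame (fun _ y => - (y / V)).
Proof. by apply: tameN; apply: tameM; [exact: tame_snd|exact: tame_cst]. Qed.

(** [dlik] and [dmean] are the derivatives in [a] of [likelihood_ratio] and [mean_ratio]; they rest
    on [gcdf' = gauss] and [gmean' = gcdf]. *)
Let dlik a y : R := expR (- (y * a / V)) *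
  (- (y / V) * gcdf v (k * (y + a)) + k * gauss v (k * (y + a))).
Let dmean a y : R := expR (- (y * a / V)) *
  (- (y / V) * (gmean v (k * (y + a)) - a * gcdf v (k * (y + a)))
   + (k * gcdf v (k * (y + a)) - (gcdf v (k * (y + a)) + a * (k * gauss v (k * (y + a)))))).

Lemma is_derive_likelihood_ratio a y :
  is_derive a 1 (likelihood_ratio Q N ^~ y) (dlik a y).
Proof.
have d1 : is_derive a 1 (fun a : R => k * (y + a)) k.
  by apply: is_derive_eq; rewrite /GRing.scale /= add0r mulr1.
have d2 := @is_derive1_comp _ (gcdf v) (fun a => k * (y + a)) a _ _ (is_derive_gcdf v v0 (k * (y + a))) d1.
have d3 : is_derive a 1 (fun a => expR (- (y * a / V))) (- (y / V) * expR (- (y * a / V))).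
  by apply: is_derive_eq; rewrite /GRing.scale /=; ring.
refine (is_derive_eq (is_deriveM d3 d2) _).
rewrite /dlik /GRing.scale /=; ring.
Qed.

Lemma is_derive_mean_ratio a y :
  is_derive a 1 (mean_ratio Q N ^~ y) (dmean a y).
Proof.
have d1 : is_derive a 1 (fun a : R => k * (y + a)) k.
  by apply: is_derive_eq; rewrite /GRing.scale /= add0r mulr1.
have d2 := @is_derive1_comp _ (gcdf v) (fun a => k * (y + a)) a _ _ (is_derive_gcdf v v0 (k * (y + a))) d1.
have d4 := @is_derive1_comp _ (gmean v) (fun a => k * (y + a)) a _ _ (is_derive_gmean v v0 (k * (y + a))) d1.
have d3 : is_derive a 1 (fun a => expR (- (y * a / V))) (- (y / V) * expR (- (y * a / V))).
  by apply: is_derive_eq; rewrite /GRing.scale /=; ring.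
have did : is_derive a 1 (fun a : R => a) 1 by apply: is_derive_id.
pose H := is_deriveM d3 (is_deriveB d4 (is_deriveM did d2)).
refine (is_derive_eq H _).
rewrite /dmean /GRing.scale !fctE /=. ring.
Qed.

Let tame_lik : tame (likelihood_ratio Q N).
Proof. by apply: tameM => //; exact: tame_expR. Qed.

Let tame_mean : tame (mean_ratio Q N).
Proof.
apply: tameM; first exact: tame_expR.
by apply: tameB => //; apply: tameM => //; exact: tame_fst.
Qed.

Let tame_dlik : tame dlik.
Proof.
apply: tameM; first exact: tame_expR.
by apply: tameD; apply: tameM => //; exact: tame_cst.
Qed.

Let tame_dmean : tame dmean.
Proof.
apply: tameM; first exact: tame_expR.
apply: tameD.
  by apply: tameM => //; apply: tameB => //; apply: tameM => //; exact: tame_fst.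
apply: tameB; first by apply: tameM => //; exact: tame_cst.
apply: tameD => //; apply: tameM; first exact: tame_fst.
by apply: tameM => //; exact: tame_cst.
Qed.

Let tame_den : tame (bpsk_den Q N).
Proof. by apply: tameD => //; exact: (tameN_snd (likelihood_ratio Q N)). Qed.

Let tame_num : tame (bpsk_num Q N).
Proof. by apply: tameB => //; exact: (tameN_snd (mean_ratio Q N)). Qed.

(** Since [a < 1], the exponent is at least [- y / V]; since [a > -1], the argument of the
    increasing [gcdf] is at least [- k]. *)
Lemma likelihood_ratio_ge a y : I a -> 0 <= y ->
  gcdf v (- k) * expR (- V^-1 * y) <= likelihood_ratio Q N a y.
Proof.
rewrite /= in_itv /= => /andP[a1 a2] y0.
rewrite mulrC ler_pM ?expR_ge0 ?gcdf_ge0 //.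
  rewrite ler_expR mulNr lerN2 (mulrC V^-1) ler_pM2r ?invr_gt0 //; nra.
have : - k <= k * (y + a) by rewrite -mulrN1 ler_pM2l //; lra.
by rewrite le_eqVlt => /predU1P[<- //|/(gcdf_lt v v0)/ltW].
Qed.

(** One of [y] and [- y] is nonnegative, and its term alone gives the denominator an exponential
    lower bound. *)
Let tame_denV : tame (fun a y => (bpsk_den Q N a y)^-1).
Proof.
apply: (tameV _ (gcdf v (- k)) V^-1) => //.
- exact: gcdf_gt0.
- by move=> a y; rewrite gt_eqF // bpsk_den_gt0.
- have lik_ge0 a y : 0 <= likelihood_ratio Q N a y.
    by rewrite mulr_ge0 ?expR_ge0 ?gcdf_ge0.
  move=> a y Ia; case: (leP 0 y) => y0.
    rewrite ger0_norm //; apply: le_trans (likelihood_ratio_ge a y Ia y0) _.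
    by rewrite lerDl.
  rewrite ltr0_norm //; apply: le_trans (likelihood_ratio_ge a (- y) Ia _) _.
    by rewrite oppr_ge0 ltW.
  by rewrite lerDr.
Qed.

(* [bpsk_energy a y * gauss V y] is the contribution [E[X1 | Y1 = y] ^ 2 * ydens y]
   of the level [y] to the second moment of the estimate *)
Definition bpsk_energy a y : R :=
  expR (- (a ^+ 2 / (2 * V))) * (bpsk_num Q N a y ^+ 2 * (bpsk_den Q N a y)^-1).

Let dnum a y := dmean a y - dmean a (- y).
Let dden a y := dlik a y + dlik a (- y).

Definition dbpsk_energy a y : R :=
  - (a / V) * bpsk_energy a y + expR (- (a ^+ 2 / (2 * V))) *
    (2 * bpsk_num Q N a y * dnum a y * (bpsk_den Q N a y)^-1
     - bpsk_num Q N a y ^+ 2 * (dden a y * (bpsk_den Q N a y)^-1 ^+ 2)).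

Let tame_expRsq : tame (fun a _ => expR (- (a ^+ 2 / (2 * V)))).
Proof.
apply: (tame_bounded_fst (fun a => expR (- (a ^+ 2 / (2 * V))))) => [a|a _].
  apply: continuous_comp; last exact: continuous_expR.
  apply: (@cvgN _ R^o); apply: cvgM; last exact: cvg_cst.
  exact: exprn_continuous.
rewrite ger0_norm ?expR_ge0 // -[leRHS]expR0 ler_expR oppr_le0.
by rewrite divr_ge0 ?sqr_ge0 // mulr_ge0 // ltW.
Qed.

Lemma tame_bpsk_energy : tame bpsk_energy.
Proof. by apply: tameM => //; apply: tameM => //; exact: tameX. Qed.

Lemma tame_dbpsk_energy : tame dbpsk_energy.
Proof.
have tdnum : tame dnum by apply: tameB => //; exact: (tameN_snd dmean).
have tdden : tame dden by apply: tameD => //; exact: (tameN_snd dlik).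
apply: tameD.
  apply: tameM; last exact: tame_bpsk_energy.
  by apply: tameN; apply: tameM; [exact: tame_fst|exact: tame_cst].
apply: tameM => //; apply: tameB.
  apply: tameM => //; apply: tameM => //; apply: tameM => //; exact: tame_cst.
by apply: tameM; [exact: tameX|apply: tameM => //; exact: tameX].
Qed.

Lemma is_derive_bpsk_energy a y : is_derive a 1 (bpsk_energy ^~ y) (dbpsk_energy a y).
Proof.
have d1 : is_derive a 1 (bpsk_num Q N ^~ y) (dnum a y).
  by apply: is_deriveB; exact: is_derive_mean_ratio.
have d2 : is_derive a 1 (bpsk_den Q N ^~ y) (dden a y).
  by apply: is_deriveD; exact: is_derive_likelihood_ratio.
have den0 : bpsk_den Q N a y != 0 by rewrite gt_eqF // bpsk_den_gt0.
have d3 := @is_deriveV _ (bpsk_den Q N ^~ y) a _ 1 den0 d2.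
have d4 : is_derive a 1 (fun a => expR (- (a ^+ 2 / (2 * V))))
    (- (a / V) * expR (- (a ^+ 2 / (2 * V)))).
  by apply: is_derive_eq; rewrite /GRing.scale /=; field; rewrite gt_eqF.
refine (is_derive_eq (is_deriveM d4 (is_deriveM (is_deriveX 2 d1) d3)) _).
rewrite /dbpsk_energy /bpsk_energy /GRing.scale !fctE /=.
by field; rewrite !gt_eqF // bpsk_den_gt0.
Qed.

Lemma tame_bpsk_den : tame (bpsk_den Q N).
Proof. exact: tame_den. Qed.

Lemma tame_mmse : tame (fun a y => bpsk_num Q N a y / bpsk_den Q N a y).
Proof. exact: tameM. Qed.

End bpsk_derivative.

(** * The BPSK cost, its derivative at zero, and the limit in the power *)

Section bpsk_cost.
Context {R : realType}.
Local Notation mu := (@lebesgue_measure R).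
Local Notation I := (`]-1, 1[%classic : set R).
Variables (Q N : R) (Q0 : 0 < Q) (N0 : 0 < N).
Implicit Types a x y : R.

Let V := Q + N.
Let k := Q / V.
Let v := Q * N / V.

Let V0 : 0 < V. Proof. exact: addr_gt0. Qed.
Let v0 : 0 < v. Proof. by rewrite divr_gt0 ?mulr_gt0. Qed.

(** Away from [0], [(x - a * sg x) ^+ 2 = x ^+ 2 - 2 * a * |x| + a ^+ 2], and [2 * Q * gauss Q 0] is
    [E|X0|]. *)
Lemma second_moment_bpsk a :
  second_moment Q (bpsk a) = Q - 2 * a * (2 * Q * gauss Q 0) + a ^+ 2.
Proof.
have i2 := integrable_sqr_gauss Q Q0; have i0 := integrable_gauss Q.
have i1 : mu.-integrable setT (fun x => (`|x| * gauss Q x)%:E).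
  apply: (@le_integrable _ _ _ mu _ measurableT _ (fun x => (x * gauss Q x)%:E)).
  - by apply/measurable_EFinP/measurable_funM => //; exact: measurable_gauss.
  - by move=> x _; rewrite /= lee_fin !normrM normr_id.
  - exact: integrable_id_gauss.
have j1 := integrableZl_EFin (2 * a) _ i1; have j0 := integrableZl_EFin (a ^+ 2) _ i0.
have j21 := integrableB_EFin i2 j1.
transitivity (\int[mu]_x (x ^+ 2 * gauss Q x - 2 * a * (`|x| * gauss Q x)
    + a ^+ 2 * gauss Q x)).
  apply: eq_Rintegral_neq0.
  - move=> x x0; have s1 : Num.sg x ^+ 2 = 1 by rewrite sqr_sg x0.
    rewrite /state1 /bpsk normrEsg.
    rewrite (_ : (x + _) ^+ 2 = x ^+ 2 - 2 * a * (Num.sg x * x) + a ^+ 2 * Num.sg x ^+ 2).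
      by rewrite s1; ring.
    ring.
  - apply: measurable_funM; last exact: measurable_gauss.
    by apply: measurable_funX; apply: measurable_funD => //; exact: measurable_bpsk.
  - by case/integrableP : (integrableD_EFin j21 j0) => /measurable_EFinP.
rewrite RintegralD // RintegralB // !RintegralZl //.
rewrite Rintegral_sqr_gauss // Rintegral_norm_gauss //.
by rewrite [X in _ + _ * X]/Rintegral integral_gauss /= mulr1.
Qed.

Lemma power_cost_bpsk a : P_bpsk Q a = a ^+ 2.
Proof.
rewrite /P_bpsk /power_cost.
transitivity (\int[mu]_x (a ^+ 2 * gauss Q x)).
  apply: eq_Rintegral_neq0.
  - by move=> x x0; rewrite /bpsk exprMn sqrrN sqr_sg x0 mulr1.
  - apply: measurable_funM; last exact: measurable_gauss.
    by apply: measurable_funX; exact: measurable_bpsk.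
  - by apply: measurable_funM => //; exact: measurable_gauss.
rewrite RintegralZl //; last exact: integrable_gauss.
by rewrite /Rintegral integral_gauss /= mulr1.
Qed.

Let mmseE a : mmse_est Q N (bpsk a) = (fun y => bpsk_num Q N a y / bpsk_den Q N a y).
Proof. by apply/funext => y; exact: mmse_est_bpsk. Qed.

Let measurable_mmse a : measurable_fun setT (mmse_est Q N (bpsk a)).
Proof. rewrite mmseE; exact: (tame_measurable _ a (tame_mmse Q N Q0 N0)). Qed.

Let mmse_growth a : I a -> exp_growth setT (fun _ => mmse_est Q N (bpsk a)).
Proof.
move=> Ia; rewrite mmseE; have [[C [b [C0 b0 mC]]] _ _] := tame_mmse Q N Q0 N0.
by exists C, b; split => // _ y _; exact: mC.
Qed.

Let ydens_gt0 a y : 0 < ydens Q N (bpsk a) y.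
Proof.
rewrite ydens_bpsk // mulr_gt0 ?bpsk_den_gt0 // mulr_gt0 ?expR_gt0 //.
exact: gauss_gt0.
Qed.

Let measurable_ydens a : measurable_fun setT (ydens Q N (bpsk a)).
Proof.
rewrite (_ : ydens Q N (bpsk a) =
  fun y => gauss V y * expR (- (a ^+ 2 / (2 * V))) * bpsk_den Q N a y); last first.
  by apply/funext => y; exact: ydens_bpsk.
apply: measurable_funM; first by apply: measurable_funM => //; exact: measurable_gauss.
exact: (tame_measurable _ a (tame_bpsk_den Q N Q0 N0)).
Qed.

(** In [m ^+ 2 * ydens] one power of [bpsk_den] cancels, which leaves [bpsk_energy] against the
    fixed weight [gauss V]. *)
Lemma S_bpskE a : I a -> S_bpsk Q N a =
  second_moment Q (bpsk a) - \int[mu]_y (bpsk_energy Q N a y * gauss V y).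
Proof.
move=> Ia; rewrite /S_bpsk est_costE //; last 3 first.
- exact: measurable_bpsk.
- exact: bpsk_growth.
- exact: mmse_growth.
congr (_ - _); apply: eq_Rintegral => y _.
rewrite mmse_est_bpsk // ydens_bpsk // /bpsk_energy -/V; field.
by rewrite !gt_eqF // bpsk_den_gt0.
Qed.

(** Holds for [a] of either sign, on which the maximum argument at [0] relies. *)
Lemma S_bpsk_le a : I a ->
  S_bpsk Q N a <= (1 - k) ^+ 2 * second_moment Q (bpsk a) + k ^+ 2 * N.
Proof.
move=> Ia; apply: est_cost_le_linear => //.
- exact: measurable_bpsk.
- exact: bpsk_growth.
- exact: mmse_growth.
Qed.

Let I0 : I 0. Proof. by rewrite /= in_itv /=; lra. Qed.

(** At [a = 0] the denominator is [1] by [gcdfN] and the Gaussian terms of the numerator cancel, so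
    the MMSE estimator is exactly [k * y]. *)
Lemma S_bpsk0 : S_bpsk Q N 0 = (1 - k) ^+ 2 * second_moment Q (bpsk 0) + k ^+ 2 * N.
Proof.
apply: est_cost_eq_linear => //.
- exact: measurable_bpsk.
- exact: bpsk_growth.
- exact: mmse_growth.
move=> y; rewrite mmse_est_bpsk // /bpsk_num /bpsk_den /mean_ratio /likelihood_ratio -/V -/k -/v.
rewrite !mulr0 !mul0r oppr0 expR0 !mul1r !addr0 mulrN gcdfN // divr1.
rewrite /gmean gaussN //.
rewrite (_ : _ - _ = k * y * (gcdf v (k * y) + gcdf v (- (k * y)))); last by ring.
by rewrite gcdfN // mulr1.
Qed.

Lemma S_bpsk0E : S_bpsk Q N 0 = Q * N / (Q + N).
Proof.
rewrite S_bpsk0 second_moment_bpsk /k /V; field.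
by rewrite gt_eqF.
Qed.

Let dmoment a : R := - (2 * (2 * Q * gauss Q 0)) + 2 * a.
Let G a : R := \int[mu]_y (dbpsk_energy Q N a y * gauss V y).

Let is_derive_moment a : is_derive a 1 (fun a => second_moment Q (bpsk a)) (dmoment a).
Proof.
rewrite (funext second_moment_bpsk); apply: is_derive_eq.
rewrite /dmoment /GRing.scale /=; ring.
Qed.

Let near_I a : I a -> \forall b \near a, I b.
Proof. by move=> Ia; apply: (open_nbhs_nbhs); split => //; exact: interval_open. Qed.

Lemma is_derive_S_bpsk a : I a -> is_derive a 1 (S_bpsk Q N) (dmoment a - G a).
Proof.
move=> Ia.
have dF := tame_derive_integral V V0 _ _ a (tame_bpsk_energy Q N Q0 N0)
  (tame_dbpsk_energy Q N Q0 N0) (is_derive_bpsk_energy Q N Q0 N0) Ia.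
apply: near_eq_is_derive (is_deriveB (is_derive_moment a) dF).
by near=> b; rewrite [RHS]S_bpskE //; near: b; exact: near_I.
Unshelve. all: by end_near. Qed.

(** With [L] the linear bound, [S - L] has an interior maximum at [0], so [S'(0) = L'(0)]; the
    integral [G 0] is never evaluated directly. *)
Lemma derive_S_bpsk0 :
  dmoment 0 - G 0 = - (2 * (1 - k) ^+ 2 * (2 * Q * gauss Q 0)).
Proof.
pose L a := (1 - k) ^+ 2 * second_moment Q (bpsk a) + k ^+ 2 * N.
have dL a : is_derive a 1 L ((1 - k) ^+ 2 * dmoment a).
  have := is_derive_moment a => H; apply: is_derive_eq.
  by rewrite addr0.
have dSL a : I a -> is_derive a 1 (fun a => S_bpsk Q N a - L a)
    (dmoment a - G a - (1 - k) ^+ 2 * dmoment a).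
  by move=> Ia; have dS := is_derive_S_bpsk a Ia; exact: is_deriveB.
have H0 := dSL 0 I0.
have D0 : is_derive (0 : R) 1 (fun a => S_bpsk Q N a - L a) 0.
  apply: (@derive1_at_max _ _ (-1) 1).
  - lra.
  - by move=> t It; apply: ex_derive; apply: dSL.
  - exact: I0.
  - move=> t It; rewrite [leRHS](_ : _ = 0) ?subr_le0 ?S_bpsk_le //.
    by rewrite S_bpsk0 subrr.
have := derive_val (is_derive := D0); rewrite (derive_val (is_derive := H0)).
rewrite /dmoment => /eqP; rewrite subr_eq0 => /eqP ->; ring.
Qed.

Lemma continuous_derive_S_bpsk : {for 0, continuous (fun a => dmoment a - G a)}.
Proof.
apply: (@cvgB _ R^o).
  apply: (@cvgD _ R^o); first exact: cvg_cst.
  by apply: cvgM; [exact: cvg_cst|exact: cvg_id].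
apply: (tame_continuous_integral V V0 _ (tame_dbpsk_energy Q N Q0 N0)).
by rewrite inE; exact: I0.
Qed.

Lemma derive_S_bpsk_cvg :
  derive1 (S_bpsk Q N) x / (2 * x) @[x --> 0^'+] --> -oo.
Proof.
have k1 : 0 < 1 - k.
  by rewrite subr_gt0 ltr_pdivrMr // mul1r ltrDl.
(* [c] is half of [|S'(0)|], so that [S' < - c] near [0] by continuity. *)
pose c := (1 - k) ^+ 2 * (2 * Q * gauss Q 0).
have c0 : 0 < c by rewrite mulr_gt0 ?exprn_gt0 // !mulr_gt0 ?gauss_gt0.
have nearc : \forall a \near (0 : R), dmoment a - G a < - c.
  have H : dmoment a - G a @[a --> (0 : R)] --> - (2 * (1 - k) ^+ 2 * (2 * Q * gauss Q 0)).
    by rewrite -derive_S_bpsk0; exact: continuous_derive_S_bpsk.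
  apply: (cvgr_lt _ H); rewrite ltrN2.
  by rewrite (_ : 2 * _ * _ = 2 * c); [lra|rewrite /c; ring].
apply/cvgrNyPle => A; near=> x.
have x0 : 0 < x by near: x; exact: nbhs_right_gt.
have Ix : I x.
  by near: x; apply: cvg_within; exact: near_I.
have Sx : derive1 (S_bpsk Q N) x <= - c.
  rewrite derive1E (derive_val (is_derive := is_derive_S_bpsk x Ix)) ltW //.
  by near: x; apply: cvg_within; exact: nearc.
rewrite ler_pdivrMr ?mulr_gt0 // (le_trans Sx) //.
(* This gives [- c <= 2 * x * A]; the added [1] keeps the divisor positive even for [A = 0]. *)
have xA : x * (2 * (`|A| + 1)) <= c.
  rewrite -ler_pdivlMr ?mulr_gt0 ?ltr_wpDl //.
  by near: x; apply: nbhs_right_le; rewrite divr_gt0 // mulr_gt0 ?ltr_wpDl.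
have := ler_norm (- A); rewrite normrN => hA; nra.
Unshelve. all: by end_near. Qed.
End bpsk_cost.

(** * The optimal linear strategy *)

Section linear_cost.
Context {R : realType}.
Variables (Q N : R) (Q0 : 0 < Q) (N0 : 0 < N).

(** Chain rule through [u = (sqrt Q - sqrt P)^2]: [dS/du = N^2 / (u + N)^2] and
    [du/dP = - (sqrt Q - sqrt P) / sqrt P]. *)
Lemma is_derive_S_lin (P : R) : 0 < P -> is_derive P 1 (S_lin Q N)
  (- ((Num.sqrt Q - Num.sqrt P) * N ^+ 2
      / (Num.sqrt P * ((Num.sqrt Q - Num.sqrt P) ^+ 2 + N) ^+ 2))).
Proof.
move=> P0; have dsqrt := is_derive1_sqrt P0.
have d1 : is_derive P 1 (fun P => (Num.sqrt Q - Num.sqrt P) ^+ 2)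
    (- ((Num.sqrt Q - Num.sqrt P) / Num.sqrt P)).
  apply: is_derive_eq; rewrite /GRing.scale /=; field.
  by rewrite gt_eqF // sqrtr_gt0.
have den0 : (Num.sqrt Q - Num.sqrt P) ^+ 2 + N != 0.
  by rewrite gt_eqF // ltr_wpDl // sqr_ge0.
have d2 : is_derive P 1 (fun P => (Num.sqrt Q - Num.sqrt P) ^+ 2 + N)
    (- ((Num.sqrt Q - Num.sqrt P) / Num.sqrt P)).
  by apply: is_derive_eq; rewrite addr0.
have d3 := @is_deriveV _ (fun P => (Num.sqrt Q - Num.sqrt P) ^+ 2 + N) P _ 1 den0 d2.
have d4 : is_derive P 1 (fun P => (Num.sqrt Q - Num.sqrt P) ^+ 2 * N)
    (- ((Num.sqrt Q - Num.sqrt P) / Num.sqrt P) * N).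
  by apply: is_derive_eq; rewrite /GRing.scale /=; ring.
refine (is_derive_eq (is_deriveM d4 d3) _).
rewrite /GRing.scale /=; field.
by rewrite den0 gt_eqF // sqrtr_gt0.
Qed.

(** Once [sqrt x <= sqrt Q / 2], the numerator of [- S'] is at least [sqrt Q / 2 * N^2] and its
    denominator at most [sqrt x * (Q + N)^2]; hence [S' <= - c / sqrt x]. *)
Lemma derive_S_lin_cvg : derive1 (S_lin Q N) x @[x --> 0^'+] --> -oo.
Proof.
pose c := Num.sqrt Q * N ^+ 2 / (2 * (Q + N) ^+ 2).
have V0 : 0 < Q + N by exact: addr_gt0.
have s0 : 0 < Num.sqrt Q by rewrite sqrtr_gt0.
have c0 : 0 < c by rewrite divr_gt0 ?mulr_gt0 ?exprn_gt0.
apply/cvgrNyPle => A; near=> x.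
have x0 : 0 < x by near: x; exact: nbhs_right_gt.
have r0 : 0 < Num.sqrt x by rewrite sqrtr_gt0.
have rs : Num.sqrt x <= Num.sqrt Q / 2.
  (* Squaring turns a bound on [sqrt x] into a bound on [x], which holds near [0]. *)
  rewrite -(ler_pXn2r (ltn0Sn 1)) ?nnegrE ?sqrtr_ge0 ?divr_ge0 //.
  rewrite expr_div_n (sqr_sqrtr (ltW x0)) (sqr_sqrtr (ltW Q0)).
  by near: x; apply: nbhs_right_le; rewrite divr_gt0.
have rA : Num.sqrt x * (`|A| + 1) <= c.
  rewrite -ler_pdivlMr ?ltr_wpDl //.
  rewrite -(ler_pXn2r (ltn0Sn 1)) ?nnegrE ?sqrtr_ge0 //; last first.
    by rewrite divr_ge0 ?ltW // ltr_wpDl.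
  rewrite (sqr_sqrtr (ltW x0)).
  by near: x; apply: nbhs_right_le; rewrite exprn_gt0 // divr_gt0 // ltr_wpDl.
rewrite derive1E (derive_val (is_derive := is_derive_S_lin x x0)).
rewrite lerNl; apply: (@le_trans _ _ (c / Num.sqrt x)).
  rewrite ler_pdivlMr //; have := ler_norm (- A); rewrite normrN => hA; nra.
have den_le : (Num.sqrt Q - Num.sqrt x) ^+ 2 + N <= Q + N.
  have := sqr_sqrtr (ltW Q0); rewrite lerD2r => E; nra.
have den0 : 0 < (Num.sqrt Q - Num.sqrt x) ^+ 2 + N by rewrite ltr_wpDl // sqr_ge0.
set D := _ + N in den_le den0 *.
rewrite (_ : c / Num.sqrt x = (Num.sqrt Q / 2 * N ^+ 2) / (Num.sqrt x * (Q + N) ^+ 2)).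
  apply: ler_pM.
  - by apply: mulr_ge0; [exact: divr_ge0|exact: sqr_ge0].
  - by rewrite invr_ge0 mulr_ge0 ?sqr_ge0 // ltW.
  - by rewrite ler_pM2r ?exprn_gt0 //; lra.
  - rewrite lef_pV2 ?posrE ?mulr_gt0 ?exprn_gt0 // ler_pM2l //.
    by rewrite ler_pXn2r ?nnegrE // ltW.
by rewrite /c; field; rewrite !gt_eqF.
Unshelve. all: by end_near. Qed.

Lemma S_lin0 : S_lin Q N 0 = Q * N / (Q + N).
Proof. by rewrite /S_lin sqrtr0 subr0 sqr_sqrtr // ltW. Qed.
End linear_cost.

(** * Infinite slope at zero power for both strategies *)

Theorem theorem2 (R : realType) (Q N : R) (hQ : 0 < Q) (hN : 0 < N) :
  (* (i) optimal linear strategy *)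
  ((forall P : R, 0 < P < Q -> derivable (S_lin Q N) P 1) /\
   derive1 (S_lin Q N) x @[x --> 0^'+] --> -oo) /\
  (* (ii) BPSK LoPE strategy *)
  ((forall a : R, 0 <= a -> P_bpsk Q a = a ^+ 2) /\
   (exists2 d : R, 0 < d &
      forall a : R, 0 < a < d -> derivable (S_bpsk Q N) a 1) /\
   (derive1 (S_bpsk Q N) x / (2 * x)) @[x --> 0^'+] --> -oo) /\
  (* common value at zero power *)
  S_lin Q N 0 = Q * N / (Q + N) /\ S_bpsk Q N 0 = Q * N / (Q + N).
Proof.
split; last split; last by split; [exact: S_lin0|exact: S_bpsk0E].
- split; last exact: derive_S_lin_cvg.
  move=> P /andP[P0 _]; apply: ex_derive; exact: is_derive_S_lin.
- split; first by move=> a _; exact: power_cost_bpsk.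
  split; last exact: derive_S_bpsk_cvg.
  (* [1] is the upper end of the interval on which the domination holds. *)
  exists 1 => // a /andP[a0 a1]; apply: ex_derive; apply: is_derive_S_bpsk => //.
  by rewrite /= in_itv /=; apply/andP; split; lra.
Qed.
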